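(* Assume that condition (ND) holds, that $k\ge1$ is an integer, and that either $k=1$ or condition (L) holds. Then: (i) For every $x\in(0,1)$, $\Delta_kF(x,x+h)$ does not converge to any real number as $h\to0$. In particular, if $\mu_0$ is absolutely continuous (with respect to Lebesgue measure), then $f_k$ is not differentiable at any point of $(0,1)$. (ii) $V(f_k;[a,b])=+\infty$ for all $0\le a<b\le1$.
   Context: Setting. Let $E\subset\mathbb{R}^3$ be the set of $(b,u,v)$ with $0<b<1$, $b-1<u<\frac1b-1$, $-b<v<\frac{b}{1-b}$, and such that $(1+v)(1-b(1+u))^2<1-b$ or $(b+v)^2<b(1+u)(1+v)^2$. Fix an open interval $I\ni 0$ and a smooth ($C^\infty$) curve $t\mapsto(b_1(t),c_0(t),c_1(t))\in E$, $t\in I$; write $b_1,c_0,c_1$ for the values at $t=0$. For $A=\begin{pmatrix}a&b\\c&d\end{pmatrix}$ put $\Phi(A;z)=\frac{az+b}{cz+d}$, and let $$A_0(t)=\begin{pmatrix}b_1(t)(1+c_0(t))&0\\c_0(t)&1\end{pmatrix},\quad A_1(t)=\begin{pmatrix}1-b_1(t)+c_1(t)&b_1(t)\\c_1(t)&1\end{pmatrix}.$$ For $t\in I$, $F(t,\cdot)$ is the unique continuous $f:[0,1]\to[0,1]$ with $f(x)=\Phi(A_0(t);f(2x))$ for $0\le x\le\frac12$ and $f(x)=\Phi(A_1(t);f(2x-1))$ for $\frac12\le x\le1$; it is strictly increasing with $F(t,0)=0$, $F(t,1)=1$, and $\mu_t$ is the probability measure on $[0,1]$ with distribution function $F(t,\cdot)$.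 It is known that $\mu_0$ is absolutely continuous if $c_0=\frac1{2b_1}-1$ and $c_1=1-2b_1$, and singular otherwise. Write $F(x)=F(0,x)$, $f_k(x)=\partial_t^kF(0,x)$ (these exist and are continuous in $x$), $\Delta_kF(x,y)=\frac{f_k(x)-f_k(y)}{F(x)-F(y)}$ for $x\ne y$. $V(g;[a,b])=\sup\{\sum_{i=1}^n|g(t_i)-g(t_{i-1})|: a=t_0<\dots<t_n=b\}$. Condition (L): $(b_1(t),c_0(t),c_1(t))=(t+a,0,0)$ for some $a\in(0,1)$. Condition (ND). Put $G_0(t,y)=b_1(t)(1+c_0(t))y+c_0(t)$, $G_1(t,y)=\frac{(1-b_1(t)+c_1(t))y+c_1(t)}{b_1(t)y+1}$, $\alpha=\min\{0,\frac{c_0}{1-b_1(1+c_0)},\frac{c_1}{b_1}\}$, $\beta=\max\{0,\frac{c_0}{1-b_1(1+c_0)},\frac{c_1}{b_1}\}$. The dual curve is $(\widetilde b_1,\widetilde c_0,\widetilde c_1)(t)=\left(1-b_1(t),-\frac{c_1(t)}{1+c_1(t)},-\frac{c_0(t)}{1+c_0(t)}\right)$, and $\widetilde G_i,\widetilde\alpha,\widetilde\beta$ are defined from it by the same formulas. Let $\delta_i=\min_{y\in[\alpha,\beta]}\frac{\partial_tG_i(0,y)}{1-\partial_yG_i(0,y)}$, $\widetilde\delta_i=\max_{y\in[\widetilde\alpha,\widetilde\beta]}\frac{\partial_t\widetilde G_i(0,y)}{1-\partial_y\widetilde G_i(0,y)}$, $i=0,1$ ($\delta_1$ is considered defined only if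 $\partial_yG_1(0,\cdot)<1$ on $[\alpha,\beta]$, $\widetilde\delta_1$ only if $\partial_y\widetilde G_1(0,\cdot)<1$ on $[\widetilde\alpha,\widetilde\beta]$; at least one is defined). (ND) means: either $\delta_1$ is defined and $b_1'(0)(\alpha+1)+b_1(1-b_1)\min\{0,\delta_0,\delta_1\}>0$, or $\widetilde\delta_1$ is defined and $\widetilde b_1'(0)(\widetilde\alpha+1)+\widetilde b_1(0)(1-\widetilde b_1(0))\max\{0,\widetilde\delta_0,\widetilde\delta_1\}<0$. *)

(* Defs.v *)
From mathcomp Require Import all_boot all_order all_algebra.
From mathcomp Require Import all_classical all_reals all_analysis.
Import Order.TTheory GRing.Theory Num.Theory.
Import numFieldNormedType.Exports.

Set Implicit Arguments.
Unset Strict Implicit.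
Unset Printing Implicit Defensive.

Local Open Scope classical_set_scope.
Local Open Scope ring_scope.

Definition E_set (R : realType) : set (R * R * R) :=
  [set p | let: (b, u, v) := p in
    [/\ 0 < b < 1,
        b - 1 < u < b^-1 - 1,
        - b < v < b / (1 - b) &
        (1 + v) * (1 - b * (1 + u)) ^+ 2 < 1 - b \/
        (b + v) ^+ 2 < b * (1 + u) * (1 + v) ^+ 2]].

(* Curves are total functions of t; only their values on the parameter
   interval are constrained or used. *)
Record curve (R : realType) := Curve {
  b1 : R -> R;
  c0 : R -> R;
  c1 : R -> R }.

(* On an open I the iterated derivatives at points of I depend only on the
   values of g on I. *)
Definition smooth_on (R : realType) (I : set R) (g : R -> R) : Prop :=
  forall (n : nat) (t : R), I t -> derivable (derive1n n g) t 1.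

Definition smooth_curve_in_E (R : realType) (I : set R) (g : curve R) : Prop :=
  [/\ smooth_on I (b1 g), smooth_on I (c0 g), smooth_on I (c1 g) &
      forall t, I t -> E_set (b1 g t, c0 g t, c1 g t)].

Definition mx2 (R : realType) (a b c d : R) : 'M[R]_2 :=
  \matrix_(i < 2, j < 2)
    if i == 0 then (if j == 0 then a else b) else (if j == 0 then c else d).

Definition Phi (R : realType) (A : 'M[R]_2) (z : R) : R :=
  (A 0 0 * z + A 0 1) / (A 1 0 * z + A 1 1).

Definition A0 (R : realType) (g : curve R) (t : R) : 'M[R]_2 :=
  mx2 (b1 g t * (1 + c0 g t)) 0
      (c0 g t)                1.

Definition A1 (R : realType) (g : curve R) (t : R) : 'M[R]_2 :=
  mx2 (1 - b1 g t + c1 g t) (b1 g t)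
      (c1 g t)              1.

(* A function [0,1] -> [0,1] is represented by a total function R -> R whose
   values outside [0,1] are irrelevant. *)
Definition solves_functional_equation (R : realType) (B0 B1 : 'M[R]_2)
    (f : R -> R) : Prop :=
  [/\ {within `[0, 1], continuous f},
      forall x, 0 <= x <= 1 -> 0 <= f x <= 1,
      forall x, 0 <= x <= 2^-1 -> f x = Phi B0 (f (2 * x)) &
      forall x, 2^-1 <= x <= 1 -> f x = Phi B1 (f (2 * x - 1))].

(* A probability measure on [0,1] is a probability measure on R giving mass 1 to
   [0,1]. *)
Definition has_distribution_function (R : realType)
    (mu : probability (measurableTypeR R) R) (f : R -> R) : Prop :=
  mu `[0, 1]%classic = 1%E /\
  forall x : R, 0 <= x <= 1 -> mu `]-oo, x]%classic = (f x)%:E.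

(* derive1n is total; that these derivatives exist at t = 0 is a consequence of
   F t solving the functional equation along a smooth curve in E. *)
Definition f_ (R : realType) (F : R -> R -> R) (k : nat) (x : R) : R :=
  derive1n k (fun t => F t x) 0.

Definition Delta (R : realType) (F : R -> R -> R) (k : nat) (x y : R) : R :=
  (f_ F k x - f_ F k y) / (F 0 x - F 0 y).

Definition condL (R : realType) (I : set R) (g : curve R) : Prop :=
  exists2 a : R, 0 < a < 1 &
    forall t, I t -> [/\ b1 g t = t + a, c0 g t = 0 & c1 g t = 0].

Definition dual (R : realType) (g : curve R) : curve R :=
  {| b1 := fun t => 1 - b1 g t;
     c0 := fun t => - (c1 g t / (1 + c1 g t));
     c1 := fun t => - (c0 g t / (1 + c0 g t)) |}.

Definition G0 (R : realType) (g : curve R) (t y : R) : R :=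
  b1 g t * (1 + c0 g t) * y + c0 g t.

Definition G1 (R : realType) (g : curve R) (t y : R) : R :=
  ((1 - b1 g t + c1 g t) * y + c1 g t) / (b1 g t * y + 1).

Definition alpha (R : realType) (g : curve R) : R :=
  Num.min 0 (Num.min (c0 g 0 / (1 - b1 g 0 * (1 + c0 g 0))) (c1 g 0 / b1 g 0)).

Definition beta (R : realType) (g : curve R) : R :=
  Num.max 0 (Num.max (c0 g 0 / (1 - b1 g 0 * (1 + c0 g 0))) (c1 g 0 / b1 g 0)).

Definition slope_values (R : realType) (g : curve R) (G : R -> R -> R) : set R :=
  [set derive1 (fun t => G t y) 0 / (1 - derive1 (G 0) y) | y in `[alpha g, beta g]].

Definition is_min (R : realType) (S : set R) (m : R) : Prop :=
  S m /\ lbound S m.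

Definition is_max (R : realType) (S : set R) (m : R) : Prop :=
  S m /\ ubound S m.

(* The analogous condition for G0 always holds: b1 (1 + c0) < 1 on E. *)
Definition delta1_defined (R : realType) (g : curve R) : Prop :=
  forall y, alpha g <= y <= beta g -> derive1 (G1 g 0) y < 1.

Definition condND_min (R : realType) (g : curve R) : Prop :=
  delta1_defined g /\
  exists d0 d1 : R,
    [/\ is_min (slope_values g (G0 g)) d0,
        is_min (slope_values g (G1 g)) d1 &
        derive1 (b1 g) 0 * (alpha g + 1)
          + b1 g 0 * (1 - b1 g 0) * Num.min 0 (Num.min d0 d1) > 0].

Definition condND_max (R : realType) (g : curve R) : Prop :=
  delta1_defined g /\
  exists d0 d1 : R,
    [/\ is_max (slope_values g (G0 g)) d0,
        is_max (slope_values g (G1 g)) d1 &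
        derive1 (b1 g) 0 * (alpha g + 1)
          + b1 g 0 * (1 - b1 g 0) * Num.max 0 (Num.max d0 d1) < 0].

Definition condND (R : realType) (g : curve R) : Prop :=
  condND_min g \/ condND_max (dual g).

(* Main.v *)
(** Write [j/2^n] for the dyadic points.  Iterating the functional equation on a
    dyadic interval shows that its left half receives the share
    [p = b (1+y) / (1+b y)] of its [F(t,.)]-increment, where [y] is the ratio
    of the interval: it is 0 for [[0,1]] and transforms by [G0(t,.)], [G1(t,.)]
    when passing to the left and right half.  Hence the slopes [Delta_k F] of the
    two halves of a dyadic interval differ by a jump, which for [k = 1] is
    [(b' (1+y) + b (1-b) y') / (b (1-b) (1+y))]; condition (ND), for the curve or
    for its dual, keeps it away from 0, because [y] stays in [[alpha, beta]] and
    [y'] is only ever averaged with slope values.  Under (L) one has [y = 0], and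
    the jump for [k + 1] is a nonzero constant times the slope for [k].

    (i) If [Delta_k F(x, x+h)] converged, the slopes over the dyadic intervals
    shrinking to [x] would converge, and the jumps would tend to 0.

    (ii) Under the measure [mu_0] the slopes form a martingale.  If [f_k] had
    bounded variation, the integrals of [sqrt(1 + slope^2)] over the levels would
    be bounded; the gain in convexity from one level to the next then forces the
    jumps to 0 in [mu_0]-measure.

    If [mu_0] is absolutely continuous, the same argument for [f(x) = x] forces
    [p] to 1/2 in measure, so that [G0] and [G1] have the common fixed point
    [(1-2b)/b]; this determines [c_0] and [c_1], and then [F] is an explicit
    Moebius map with nonzero derivative, so differentiability of [f_k] would
    again make the slopes converge. *)
Require Import Defs.
From mathcomp Require Import all_boot all_order all_algebra.
From mathcomp Require Import all_classical all_reals all_analysis.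
From mathcomp Require Import zify ring lra.
Import Order.TTheory GRing.Theory Num.Theory.
Import numFieldNormedType.Exports.
Local Open Scope classical_set_scope.
Local Open Scope ring_scope.
Set Implicit Arguments.
Unset Strict Implicit.

(** * Sums over the dyadic tree *)

Definition dyadic (R : realType) (n j : nat) : R := j%:R / 2 ^+ n.

Definition incr (R : realType) (h : R -> R) (n j : nat) : R :=
  h (dyadic R n j.+1) - h (dyadic R n j).

Definition slope (R : realType) (h f : R -> R) (n j : nat) : R :=
  incr f n j / incr h n j.

Definition jump (R : realType) (h f : R -> R) (n j : nat) : R :=
  slope h f n.+1 j.*2 - slope h f n.+1 j.*2.+1.

(** Both halves keep a fixed share of the [h]-mass, which makes jumps comparable to slope
    differences between consecutive levels. *)
Definition doubling (R : realType) (c : R) (h : R -> R) : Prop :=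
  forall n j, (j < 2 ^ n)%N ->
  [/\ 0 < incr h n j,
      c * incr h n j <= incr h n.+1 j.*2 &
      c * incr h n j <= incr h n.+1 j.*2.+1].

(* Sum of [X] over the descendants of [(n, j)] that are [m] levels below it in
   the tree of dyadic intervals. *)
Fixpoint tsum (R : realType) (X : nat -> nat -> R) (m n j : nat) : R :=
  if m is m'.+1 then tsum X m' n.+1 j.*2 + tsum X m' n.+1 j.*2.+1
  else X n j.

(** With [h] read as a distribution function, this is the measure of the union of the descendants on
    one level that satisfy [Q]. *)
Definition mass (R : realType) (h : R -> R) (Q : nat -> nat -> bool) :=
  tsum (fun n j => if Q n j then incr h n j else 0).

(** Convergence to 0 in measure, on the interval [(n, j)], of the step functions formed by the
    levels of [X]. *)
Definition cvg0_in_mass (R : realType) (h : R -> R) (X : nat -> nat -> R)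
    (n j : nat) : Prop :=
  forall e d : R, 0 < e -> 0 < d -> exists N, forall m, (N <= m)%N ->
  mass h (fun n j => e <= `|X n j|) m n j <= d.

Lemma dyadic_double (R : realType) n j : dyadic R n.+1 j.*2 = dyadic R n j.
Proof.
rewrite /dyadic -mul2n natrM exprS invfM mulrACA mulfV ?mul1r//.
Qed.

Lemma dyadicB (R : realType) n j : dyadic R n j.+1 - dyadic R n j = 2 ^- n.
Proof. by rewrite /dyadic -mulrBl -natr1 addrAC subrr add0r mul1r. Qed.

Lemma dyadic_ge0 (R : realType) n j : 0 <= dyadic R n j.
Proof. by rewrite /dyadic divr_ge0// exprn_ge0. Qed.

Lemma dyadic_le1 (R : realType) n j : (j <= 2 ^ n)%N -> dyadic R n j <= 1.
Proof.
by move=> jn; rewrite /dyadic ler_pdivrMr ?exprn_gt0// mul1r -natrX ler_nat.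
Qed.

Lemma dyadic_lt (R : realType) n j : dyadic R n j < dyadic R n j.+1.
Proof. by rewrite -subr_gt0 dyadicB invr_gt0 exprn_gt0. Qed.

Lemma incr_split (R : realType) (h : R -> R) n j :
  incr h n j = incr h n.+1 j.*2 + incr h n.+1 j.*2.+1.
Proof. by rewrite /incr -doubleS !dyadic_double; ring. Qed.

Lemma ltn_double_exp n j : (j < 2 ^ n)%N -> (j.*2 < 2 ^ n.+1)%N.
Proof. by rewrite expnS mul2n ltn_double. Qed.

Lemma ltn_doubleS_exp n j : (j < 2 ^ n)%N -> (j.*2.+1 < 2 ^ n.+1)%N.
Proof. by rewrite expnS mul2n ltn_Sdouble. Qed.

(** The definition unfolds at the root; unfolding at the leaves lets two consecutive levels be
    compared interval by interval. *)
Lemma tsum_leaf (R : realType) (X : nat -> nat -> R) m n j :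
  tsum X m.+1 n j =
  tsum (fun n j => X n.+1 j.*2 + X n.+1 j.*2.+1) m n j.
Proof.
elim: m n j => [//|m IH] n j.
transitivity (tsum X m.+1 n.+1 j.*2 + tsum X m.+1 n.+1 j.*2.+1); first by [].
by rewrite !IH.
Qed.

Lemma tsum_le (R : realType) (X Y : nat -> nat -> R) m n j :
  (forall n j, (j < 2 ^ n)%N -> X n j <= Y n j) -> (j < 2 ^ n)%N ->
  tsum X m n j <= tsum Y m n j.
Proof.
move=> XY; elim: m n j => [|m IH] n j jn /=; first exact: XY.
by apply: lerD; apply: IH; [exact: ltn_double_exp|exact: ltn_doubleS_exp].
Qed.

Lemma tsumD (R : realType) (X Y : nat -> nat -> R) m n j :
  tsum (fun n j => X n j + Y n j) m n j = tsum X m n j + tsum Y m n j.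
Proof. by elim: m n j => [//|m IH] n j /=; rewrite !IH addrACA. Qed.

Lemma tsumZ (R : realType) a (X : nat -> nat -> R) m n j :
  tsum (fun n j => a * X n j) m n j = a * tsum X m n j.
Proof. by elim: m n j => [//|m IH] n j /=; rewrite !IH mulrDr. Qed.

Lemma tsum_incr (R : realType) (h : R -> R) m n j :
  tsum (incr h) m n j = incr h n j.
Proof. by elim: m n j => [//|m IH] n j /=; rewrite !IH -incr_split. Qed.

Lemma tsum_ge0 (R : realType) (X : nat -> nat -> R) m n j :
  (forall n j, (j < 2 ^ n)%N -> 0 <= X n j) -> (j < 2 ^ n)%N ->
  0 <= tsum X m n j.
Proof.
move=> X0; elim: m n j => [|m IH] n j jn /=; first exact: X0.
by apply: addr_ge0; apply: IH; [exact: ltn_double_exp|exact: ltn_doubleS_exp].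
Qed.

Lemma mass_ge0 (R : realType) c (h : R -> R) Q m n j :
  doubling c h -> (j < 2 ^ n)%N -> 0 <= mass h Q m n j.
Proof.
move=> dh jn; apply: tsum_ge0 => // {}n {}j {}jn; case: ifP => // _.
by have [/ltW] := dh n j jn.
Qed.

Lemma mass_le (R : realType) c (h : R -> R) (P Q : nat -> nat -> bool) m n j :
  doubling c h -> (forall n j, (j < 2 ^ n)%N -> P n j -> Q n j) ->
  (j < 2 ^ n)%N -> mass h P m n j <= mass h Q m n j.
Proof.
move=> dh PQ jn; apply: tsum_le => // {}n {}j {}jn.
have [/ltW h0 _ _] := dh n j jn.
case: ifP => [/(PQ _ _ jn) -> //|_]; by case: ifP.
Qed.

Lemma massU (R : realType) c (h : R -> R) (P Q S : nat -> nat -> bool) m n j :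
  doubling c h -> (forall n j, (j < 2 ^ n)%N -> P n j -> Q n j || S n j) ->
  (j < 2 ^ n)%N -> mass h P m n j <= mass h Q m n j + mass h S m n j.
Proof.
move=> dh PQ jn; rewrite /mass -tsumD; apply: tsum_le => // {}n {}j {}jn.
have [/ltW h0 _ _] := dh n j jn.
case: ifP => [/(PQ _ _ jn)|_].
  by case/orP => ->; [rewrite lerDl; case: ifP|rewrite lerDr; case: ifP].
by apply: addr_ge0; case: ifP.
Qed.

(** A child in [Q] holds at least the share [c] of its parent, so the mass of parents of bad
    children is controlled up to the factor [c]. *)
Lemma mass_child (R : realType) c (h : R -> R) (P Q : nat -> nat -> bool) m n j :
  0 < c -> doubling c h ->
  (forall n j, (j < 2 ^ n)%N -> P n j -> Q n.+1 j.*2 || Q n.+1 j.*2.+1) ->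
  (j < 2 ^ n)%N -> c * mass h P m n j <= mass h Q m.+1 n j.
Proof.
move=> c0 dh PQ jn; rewrite /mass tsum_leaf -tsumZ; apply: tsum_le => // {}n {}j {}jn.
have [/ltW h0 h1 h2] := dh n j jn.
have ch : 0 <= c * incr h n j by rewrite mulr_ge0// ltW.
have h3 := le_trans ch h1; have h4 := le_trans ch h2.
case: ifP => [/(PQ _ _ jn)|_]; last by rewrite mulr0 addr_ge0//; case: ifP.
case/orP => ->.
  by rewrite -[leLHS]addr0 lerD//; case: ifP.
by rewrite -[leLHS]add0r lerD//; case: ifP.
Qed.

(** The weights are the shares of [h]-mass: this is the martingale property of the slopes. *)
Lemma slope_parent (R : realType) c (h f : R -> R) n j :
  0 < c -> doubling c h -> (j < 2 ^ n)%N ->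
  exists p, [/\ c <= p, c <= 1 - p,
    incr h n.+1 j.*2 = p * incr h n j,
    incr h n.+1 j.*2.+1 = (1 - p) * incr h n j &
    slope h f n j =
      p * slope h f n.+1 j.*2 + (1 - p) * slope h f n.+1 j.*2.+1].
Proof.
move=> c0 dh jn; have [h0 h1 h2] := dh n j jn.
have e1 := incr_split h n j; have e2 := incr_split f n j.
have ch : 0 < c * incr h n j by rewrite mulr_gt0.
have h3 := lt_le_trans ch h1; have h4 := lt_le_trans ch h2.
have ep : 1 - incr h n.+1 j.*2 / incr h n j =
    incr h n.+1 j.*2.+1 / incr h n j.
  by rewrite e1; field; rewrite -e1 gt_eqF.
exists (incr h n.+1 j.*2 / incr h n j); split.
- by rewrite ler_pdivlMr.
- by rewrite ep ler_pdivlMr.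
- by rewrite divfK ?gt_eqF.
- by rewrite ep divfK ?gt_eqF.
- by rewrite ep /slope e2; field; rewrite !gt_eqF.
Qed.

(** A child differs from the weighted mean by the weight of its sibling times the jump, and that
    weight is at least [c]. *)
Lemma slope_child_dist (R : realType) c (h f : R -> R) n j :
  0 < c -> doubling c h -> (j < 2 ^ n)%N ->
  c * `|jump h f n j| <= `|slope h f n.+1 j.*2 - slope h f n j| /\
  c * `|jump h f n j| <= `|slope h f n.+1 j.*2.+1 - slope h f n j|.
Proof.
move=> c0 dh jn; have [p [cp cq _ _ ->]] := slope_parent f c0 dh jn.
set u := slope _ _ _ _; set v := slope _ _ _ _; rewrite /jump -/u -/v.
have -> : u - (p * u + (1 - p) * v) = (1 - p) * (u - v) by ring.
have -> : v - (p * u + (1 - p) * v) = - (p * (u - v)) by ring.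
rewrite normrN !normrM (ger0_norm (le_trans (ltW c0) cp)).
by rewrite (ger0_norm (le_trans (ltW c0) cq)) !ler_wpM2r.
Qed.

(** A jump of size [e] puts a distance [c * e] between the slopes of an interval and of its left
    half, so one of them is at least half of that. *)
Lemma cvg0_in_mass_jump (R : realType) c (h f : R -> R) n j :
  0 < c -> doubling c h -> (j < 2 ^ n)%N ->
  cvg0_in_mass h (slope h f) n j -> cvg0_in_mass h (jump h f) n j.
Proof.
move=> c0 dh jn Sf e d e0 d0.
(* The second entry of [d'] pays for the factor [c] lost in [mass_child]. *)
pose e' := c * e / 2; pose d' := Num.min (d / 2) (c * (d / 2)).
have e'0 : 0 < e' by rewrite /e' divr_gt0// mulr_gt0.
have d'0 : 0 < d' by rewrite lt_min divr_gt0//= mulr_gt0// divr_gt0.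
have [N HN] := Sf e' d' e'0 d'0; exists N => m Nm.
pose P n j := e' <= `|slope h f n j|.
pose P1 n j := e' <= `|slope h f n.+1 j.*2|.
have hP : mass h P m n j <= d / 2.
  by apply: le_trans (HN m Nm) _; rewrite ge_min lexx.
have hP1 : mass h P1 m n j <= d / 2.
  rewrite -(ler_pM2l c0); apply: (@le_trans _ _ d');
    last by rewrite ge_min lexx orbT.
  apply: le_trans (HN m.+1 (leqW Nm)).
  apply: (mass_child _ c0 dh _ jn) => n' j' _.
  by rewrite /P1 => ->.
rewrite (splitr d); apply: le_trans (lerD hP hP1); apply: (massU _ dh) => // n' j' jn' ej.
have [h1 _] := slope_child_dist f c0 dh jn'.
have h2 : c * e <= `|slope h f n'.+1 j'.*2| + `|slope h f n' j'|.
  apply: le_trans (ler_normB _ _); apply: le_trans h1.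
  by rewrite ler_pM2l.
rewrite /P /P1; case: (leP e' _) => //= h3; rewrite leNgt; apply/negP => h4.
by move: h2; rewrite leNgt (splitr (c * e)) (addrC `|_|) ltrD.
Qed.

(** * Slopes of a function of bounded variation *)

(* Any strictly convex function of linear growth would do. *)
Definition jap (R : realType) (s : R) : R := Num.sqrt (1 + s ^+ 2).

Lemma jap_sqr (R : realType) (s : R) : jap s ^+ 2 = 1 + s ^+ 2.
Proof. by rewrite sqr_sqrtr// addr_ge0// sqr_ge0. Qed.

Lemma jap_ge1 (R : realType) (s : R) : 1 <= jap s.
Proof. by rewrite -[leLHS]sqrtr1 ler_wsqrtr// lerDl sqr_ge0. Qed.

Lemma jap_le (R : realType) (s : R) : jap s <= 1 + `|s|.
Proof.
rewrite -(ler_pXn2r (_ : 0 < 2)%N) ?nnegrE ?sqrtr_ge0 ?addr_ge0//.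
rewrite jap_sqr -(real_normK (num_real s)); have := normr_ge0 s; nra.
Qed.

Lemma jap_lip (R : realType) (s u : R) : jap u <= jap s + `|u - s|.
Proof.
have s1 := jap_ge1 s; have su : `|s| <= jap s.
  rewrite -(ler_pXn2r (_ : 0 < 2)%N) ?nnegrE ?sqrtr_ge0//.
  by rewrite jap_sqr real_normK ?num_real// lerDr.
rewrite -(ler_pXn2r (_ : 0 < 2)%N) ?nnegrE ?sqrtr_ge0 ?addr_ge0 ?sqrtr_ge0//.
rewrite sqrrD !jap_sqr real_normK ?num_real//.
have : s * (u - s) <= jap s * `|u - s|.
  by rewrite (le_trans (ler_norm _))// normrM ler_wpM2r.
rewrite -mulr_natr; nra.
Qed.

(** Cauchy-Schwarz for [(1, s)] and [(1, u)]; divided by [jap s], it is the tangent line inequality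
    of [jap] at [s]. *)
Lemma jap_tangent (R : realType) (s u : R) : 1 + s * u <= jap s * jap u.
Proof.
have := jap_sqr s; have := jap_sqr u; have := jap_ge1 s; have := jap_ge1 u.
move: (jap s) (jap u) => a b b1 a1 eb ea.
rewrite leNgt; apply/negP => h.
have : (a * b) ^+ 2 < (1 + s * u) ^+ 2 by rewrite ltr_pXn2r// nnegrE; nra.
rewrite exprMn ea eb; have := sqr_ge0 (s - u); nra.
Qed.

(* [(1+s^2)(1+u^2) - (1+su)^2 = (u-s)^2] *)
Lemma jap_tangent_gap (R : realType) (s u : R) :
  (u - s) ^+ 2 <= 2 * jap s * jap u * (jap s * jap u - (1 + s * u)).
Proof.
have := jap_sqr s; have := jap_sqr u; have := jap_tangent s u.
have := jap_ge1 s; have := jap_ge1 u.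
move: (jap s) (jap u) => a b b1 a1 t eb ea.
have -> : (u - s) ^+ 2 = (a * b - (1 + s * u)) * (a * b + (1 + s * u)).
  by rewrite -subr_sqr exprMn ea eb; ring.
by rewrite mulrC ler_wpM2r ?subr_ge0//; lra.
Qed.

Lemma jap_convex (R : realType) (p s u v : R) : 0 <= p -> 0 <= 1 - p ->
  s = p * u + (1 - p) * v -> jap s <= p * jap u + (1 - p) * jap v.
Proof.
move=> p0 q0 es; have s1 := jap_ge1 s.
rewrite -(ler_pM2l (lt_le_trans ltr01 s1)) -expr2 jap_sqr.
have -> : 1 + s ^+ 2 = p * (1 + s * u) + (1 - p) * (1 + s * v).
  by rewrite expr2 {2}es; ring.
rewrite (mulrDr (jap s)) !(mulrCA (jap s)) lerD// ler_wpM2l//; exact: jap_tangent.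
Qed.

(** Lower bound for the tangent gap at distance [c * e], with [jap s] bounded by [1 + K] and [jap u]
    by [1 + K + c * e], times the weight [c]; the second factor [1 + K] comes from the division by
    [jap s]. *)
Definition jap_gain (R : realType) (c K e : R) : R :=
  c * (c * e) ^+ 2 / (2 * (1 + K) ^+ 2 * (1 + K + c * e)).

Lemma jap_gain_gt0 (R : realType) (c K e : R) :
  0 < c -> 0 < K -> 0 < e -> 0 < jap_gain c K e.
Proof.
move=> c0 K0 e0; have ce : 0 < c * e by rewrite mulr_gt0.
have K1 : 0 < 1 + K by rewrite addr_gt0.
by rewrite divr_gt0 ?mulr_gt0 ?exprn_gt0 ?addr_gt0.
Qed.

(** The tangent gap is exploited at [u] only; at [v] the plain tangent inequality suffices. The
    bound [K] on the mean keeps the convexity from degenerating. *)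
Lemma jap_strict_convex (R : realType) (c K e p s u v : R) :
  0 < c -> 0 < K -> 0 < e -> c <= p -> c <= 1 - p ->
  s = p * u + (1 - p) * v -> `|s| <= K -> e <= `|u - v| ->
  jap s + jap_gain c K e <= p * jap u + (1 - p) * jap v.
Proof.
move=> c0 K0 e0 cp cq es sK euv.
have s1 := jap_ge1 s; have u1 := jap_ge1 u.
have js : jap s <= 1 + K by apply: le_trans (jap_le s) _; rewrite lerD2l.
have ce : 0 < c * e by rewrite mulr_gt0.
pose x := `|u - s|.
have cex : c * e <= x.
  rewrite /x es; have -> : u - (p * u + (1 - p) * v) = (1 - p) * (u - v) by ring.
  rewrite normrM (ger0_norm (le_trans (ltW c0) cq)).
  by rewrite ler_pM// ltW.
have ju : jap u <= 1 + K + x.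
  by apply: le_trans (jap_lip s u) _; rewrite lerD2r.
have g1 := jap_tangent_gap s u; have g2 := jap_tangent s v.
have x2 : (u - s) ^+ 2 = x ^+ 2 by rewrite /x real_normK ?num_real.
rewrite x2 in g1.
have g0 := jap_tangent s u.
set w := jap s * jap u - (1 + s * u) in g1.
have w0 : 0 <= w by rewrite subr_ge0.
have K1 : 0 < 1 + K by rewrite addr_gt0.
have KX : 0 < 1 + K + x by rewrite addr_gt0//; exact: lt_le_trans cex.
(* [x^2 / (1+K+x)] increases with [x]. *)
have mono : (c * e) ^+ 2 * (1 + K + x) <= x ^+ 2 * (1 + K + c * e).
  rewrite -subr_ge0.
  have -> : x ^+ 2 * (1 + K + c * e) - (c * e) ^+ 2 * (1 + K + x) =
    (x - c * e) * ((1 + K) * (x + c * e) + x * (c * e)) by ring.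
  have x0 := lt_le_trans ce cex.
  by rewrite mulr_ge0 ?subr_ge0// addr_ge0// mulr_ge0 ?addr_ge0// ltW.
have xw : x ^+ 2 <= 2 * (1 + K) * (1 + K + x) * w.
  apply: le_trans g1 _; rewrite ler_wpM2r// -!mulrA ler_pM2l// ler_pM//.
    exact: le_trans ler01 s1.
  exact: le_trans ler01 u1.
have gw : jap_gain c K e * (1 + K) <= c * w.
  have -> : jap_gain c K e * (1 + K) =
     c * ((c * e) ^+ 2 / (2 * (1 + K) * (1 + K + c * e))).
    rewrite /jap_gain; field; rewrite !gt_eqF//; exact: addr_gt0.
  rewrite ler_pM2l// ler_pdivrMr; last by rewrite !mulr_gt0// addr_gt0.
  rewrite -(ler_pM2r KX); apply: le_trans mono _.
  apply: le_trans (ler_wpM2r (ltW (addr_gt0 K1 ce)) xw) _.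
  by rewrite [leLHS](_ : _ = w * (2 * (1 + K) * (1 + K + c * e)) * (1 + K + x))//; ring.
rewrite -(ler_pM2l (lt_le_trans ltr01 s1)) mulrDr -expr2 jap_sqr.
have -> : 1 + s ^+ 2 = p * (1 + s * u) + (1 - p) * (1 + s * v).
  by rewrite expr2 {2}es; ring.
have -> : jap s * (p * jap u + (1 - p) * jap v) =
  p * (jap s * jap u) + (1 - p) * (jap s * jap v) by ring.
have h1 : p * w + p * (1 + s * u) = p * (jap s * jap u) by rewrite /w; ring.
have h2 : (1 - p) * (1 + s * v) <= (1 - p) * (jap s * jap v).
  by rewrite ler_wpM2l// (le_trans (ltW c0)).
have h3 : jap s * jap_gain c K e <= p * w.
  apply: (@le_trans _ _ (c * w)); last by rewrite ler_wpM2r.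
  apply: le_trans gw; rewrite mulrC ler_wpM2l//.
  exact/ltW/jap_gain_gt0.
lra.
Qed.

Lemma bounded_series_small (R : realType) (q : nat -> R) (B : R) :
  (forall n, 0 <= q n) -> (forall n, \sum_(i < n) q i <= B) ->
  forall d, 0 < d -> exists N, forall m, (N <= m)%N -> q m <= d.
Proof.
move=> q0 qB d d0.
have cv : cvgn (series q).
  apply: nondecreasing_is_cvgn.
    by apply: nondecreasing_series => n _ _; exact: q0.
  by exists B => _ [n _ <-]; rewrite /series/= big_mkord.
have := cvg_series_cvg_0 cv.
move=> /cvgrPdist_le/(_ d d0)[N _ HN]; exists N => m Nm.
have := HN m Nm; rewrite sub0r normrN; apply: le_trans; exact: ler_norm.
Qed.

(** Each level adds to the bounded sums [W] at least a constant times the mass where the slope is at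
    most [K] and the jump at least [e], so this mass tends to 0. Slopes above [K] are handled by the
    Markov inequality. *)
Lemma jump_cvg0_of_bounded_variation (R : realType) (c : R) (h f : R -> R) n j (C : R) :
  0 < c -> doubling c h -> (j < 2 ^ n)%N ->
  (forall m, tsum (fun n j => `|incr f n j|) m n j <= C) ->
  cvg0_in_mass h (jump h f) n j.
Proof.
move=> c0 dh jn fC e d e0 d0.
have C0 : 0 <= C.
  by apply: le_trans (fC 0%N) => /=.
(* Chosen so that the Markov bound [C / K] is at most [d / 2]; [C + 1] keeps [K] positive when
   [C = 0]. *)
pose K := (C + 1) / (d / 2).
have K0 : 0 < K by rewrite divr_gt0 ?ltr_wpDl// divr_gt0.
(* Length of the dyadic polygon inscribed in the plane curve with coordinates [h] and [f]. *)
pose W m := tsum (fun n j => incr h n j * jap (slope h f n j)) m n j.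
pose Q n j := (`|slope h f n j| <= K) && (e <= `|jump h f n j|).
pose g := jap_gain c K e.
have g0 : 0 < g by exact: jap_gain_gt0.
have W0 : forall m, 0 <= W m.
  move=> m; apply: tsum_ge0 => // n' j' jn'; have [/ltW i0 _ _] := dh _ _ jn'.
  by rewrite mulr_ge0// sqrtr_ge0.
have WC : forall m, W m <= incr h n j + C.
  move=> m; apply: (le_trans _ (lerD (lexx _) (fC m))).
  rewrite -(tsum_incr h m) -tsumD; apply: tsum_le => // n' j' jn'.
  have [i0 _ _] := dh _ _ jn'.
  apply: (@le_trans _ _ (incr h n' j' * (1 + `|slope h f n' j'|))).
    by rewrite ler_pM2l// jap_le.
  rewrite mulrDr mulr1 lerD2l /slope normrM normfV (gtr0_norm i0) mulrCA.
  by rewrite divff ?gt_eqF// mulr1.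
have Wstep : forall m, W m + g * mass h Q m n j <= W m.+1.
  move=> m; rewrite /W tsum_leaf /mass -tsumZ -tsumD; apply: tsum_le => // n' j' jn'.
  have [i0 _ _] := dh _ _ jn'.
  have [p [cp cq -> -> es]] := slope_parent f c0 dh jn'.
  have p0 := le_trans (ltW c0) cp; have p1 := le_trans (ltW c0) cq.
  have -> : p * incr h n' j' * jap (slope h f n'.+1 j'.*2) +
    (1 - p) * incr h n' j' * jap (slope h f n'.+1 j'.*2.+1) =
    incr h n' j' * (p * jap (slope h f n'.+1 j'.*2) +
      (1 - p) * jap (slope h f n'.+1 j'.*2.+1)) by ring.
  case: ifP => [/andP[sK ej]|_].
    by rewrite (mulrC g) -mulrDr ler_pM2l// (jap_strict_convex c0).
  by rewrite mulr0 addr0 ler_pM2l// jap_convex.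
have WQ : forall m, W 0%N + g * \sum_(i < m) mass h Q i n j <= W m.
  elim=> [|m IH]; first by rewrite big_ord0 mulr0 addr0.
  rewrite big_ord_recr/= mulrDr addrA; apply: le_trans (Wstep m).
  by rewrite lerD2r.
have [|m||N HN] := @bounded_series_small R (fun m => mass h Q m n j)
    ((incr h n j + C) / g) _ _ (d / 2) _.
- by move=> m; exact: mass_ge0 _ _ dh jn.
- rewrite ler_pdivlMr// mulrC; have := WQ m; have := WC m; have := W0 0%N; lra.
- by rewrite divr_gt0.
exists N => m Nm.
pose P n j := K < `|slope h f n j|.
have hP : mass h P m n j <= d / 2.
  have KC : C / K <= d / 2.
    rewrite /K invf_div mulrCA -[leRHS]mulr1 ler_pM2l ?divr_gt0//.
    by rewrite ler_pdivrMr ?ltr_wpDl// mul1r lerDl.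
  apply: le_trans KC; rewrite ler_pdivlMr// mulrC.
  apply: le_trans (fC m); rewrite /mass -tsumZ; apply: tsum_le => // n' j' jn'.
  have [i0 _ _] := dh _ _ jn'.
  case: ifP => [/ltW Ks|_]; last by rewrite mulr0.
  apply: (le_trans (ler_wpM2r (ltW i0) Ks)).
  by rewrite /slope normrM normfV (gtr0_norm i0) divfK ?gt_eqF.
rewrite (splitr d); apply: le_trans (lerD (HN m Nm) hP); apply: (massU _ dh) => // n' j' jn' ej.
by rewrite /Q /P ej andbT; case: leP.
Qed.

(** * Nested dyadic intervals and total variation *)

(** The path of [x] down the tree; a point that is a midpoint continues into the right half. *)
Fixpoint index_at (R : realType) (x : R) (n : nat) : nat :=
  if n is n'.+1 then
    let j := index_at x n' in
    if x < dyadic R n'.+1 j.*2.+1 then j.*2 else j.*2.+1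
  else 0%N.

Lemma index_at_lt (R : realType) (x : R) n : (index_at x n < 2 ^ n)%N.
Proof.
elim: n => [//|n IH] /=.
by case: ifP => _; [exact: ltn_double_exp|exact: ltn_doubleS_exp].
Qed.

Lemma index_at_mem (R : realType) (x : R) n : 0 <= x <= 1 ->
  dyadic R n (index_at x n) <= x <= dyadic R n (index_at x n).+1.
Proof.
move=> x01; elim: n => [|n /andP[IH1 IH2]].
  by rewrite /dyadic /= expr0 !divr1.
rewrite [index_at _ _]/=; case: ltP => xm; apply/andP; split => //.
- by rewrite dyadic_double.
- exact: ltW.
- by rewrite -doubleS dyadic_double.
Qed.

Lemma expn2_small (R : realType) (e : R) : 0 < e ->
  exists N, forall n, (N <= n)%N -> 2 ^- n < e.
Proof.
move=> e0; have [N _ HN] := near_infty_natSinv_expn_lt (PosNum e0).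
by exists N => n Nn; rewrite -[ltLHS]mul1r; exact: HN.
Qed.

(** Consecutive slopes on the path both approach [l], and their distance is at least [c] times the
    jump, whichever half the path enters. *)
Lemma jump_cvg0_at (R : realType) c (h f : R -> R) (x l : R) :
  0 < c -> doubling c h ->
  slope h f n (index_at x n) @[n --> \oo] --> l ->
  jump h f n (index_at x n) @[n --> \oo] --> 0.
Proof.
move=> c0 dh /cvgrPdist_le sl; apply/cvgrPdist_le => e e0.
have ce : 0 < c * e / 2 by rewrite divr_gt0// mulr_gt0.
have [N _ HN] := sl _ ce; exists N => // n Nn /=; rewrite sub0r normrN.
have h1 := HN n Nn; have h2 := HN n.+1 (leqW Nn).
rewrite -(ler_pM2l c0) (splitr (c * e)).
apply: le_trans (lerD h2 h1); rewrite [in leRHS]distrC.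
have [b1 b2] := slope_child_dist f c0 dh (index_at_lt x n).
apply: le_trans (ler_distD l _ _).
by move: b1 b2; rewrite /=; case: ifP.
Qed.

(** The last hypothesis says that [f] has derivative [l] with respect to [h] at [x], multiplied out
    so that [v = x] is allowed. As [x] lies in the interval, the errors at the two endpoints add up
    to at most [e] times the increment of [h]. *)
Lemma slope_cvg_at (R : realType) (h f : R -> R) (x l : R) :
  0 <= x <= 1 -> (forall n j, (j < 2 ^ n)%N -> 0 < incr h n j) ->
  (forall n j, (j < 2 ^ n)%N -> dyadic R n j <= x <= dyadic R n j.+1 ->
     h (dyadic R n j) <= h x <= h (dyadic R n j.+1)) ->
  (forall e, 0 < e -> exists2 d, 0 < d & forall v, 0 <= v <= 1 -> `|v - x| < d ->
     `|f v - f x - l * (h v - h x)| <= e * `|h v - h x|) ->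
  slope h f n (index_at x n) @[n --> \oo] --> l.
Proof.
move=> x01 hpos hx fd; apply/cvgrPdist_le => e e0.
have [d d0 Hd] := fd e e0; have [N HN] := expn2_small d0.
exists N => // n Nn /=; have jn := index_at_lt x n.
have /andP[lx xr] := index_at_mem n x01; set j := index_at x n in jn lx xr *.
have ij := hpos n j jn; have small := HN n Nn.
have lr := dyadicB R n j.
have /andP[hl hr] := hx n j jn (introT andP (conj lx xr)).
have [l0 r1] : 0 <= dyadic R n j /\ dyadic R n j.+1 <= 1.
  by split; [exact: dyadic_ge0|exact: dyadic_le1].
move: lx xr lr hl hr ij l0 r1 => {hpos hx fd HN}.
rewrite /slope /incr; move: (dyadic R n j) (dyadic R n j.+1) => a b ax xb ab ha hb hab a0 b1.
have va := Hd a; have vb := Hd b.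
have {}va : `|f a - f x - l * (h a - h x)| <= e * (h x - h a).
  rewrite -(ger0_norm (_ : 0 <= h x - h a)) ?subr_ge0// (distrC (h x)).
  apply: va; first by apply/andP; split; lra.
  by rewrite distrC ger0_norm ?subr_ge0//; lra.
have {}vb : `|f b - f x - l * (h b - h x)| <= e * (h b - h x).
  rewrite -{2}(ger0_norm (_ : 0 <= h b - h x)) ?subr_ge0//.
  apply: vb; first by apply/andP; split; lra.
  by rewrite ger0_norm ?subr_ge0//; lra.
have -> : l - (f b - f a) / (h b - h a) =
    ((f a - f x - l * (h a - h x)) - (f b - f x - l * (h b - h x))) / (h b - h a).
  by field; rewrite gt_eqF.
rewrite normrM normfV (gtr0_norm hab) ler_pdivrMr//.
by apply: le_trans (ler_normB _ _) _; lra.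
Qed.

Lemma tsum_le_total_variation (R : realType) (f : R -> R) m n j :
  ((tsum (fun n j => `|incr f n j|) m n j)%:E <=
    total_variation (dyadic R n j) (dyadic R n j.+1) f)%E.
Proof.
elim: m n j => [|m IH] n j /=.
  by apply: total_variation_ge; exact/ltW/dyadic_lt.
rewrite EFinD (@total_variationD _ _ _ (dyadic R n.+1 j.*2.+1)).
- by apply: leeD; [rewrite -(dyadic_double R n j)|rewrite -(dyadic_double R n j.+1)]; exact: IH.
- by rewrite -dyadic_double; exact/ltW/dyadic_lt.
- by rewrite -(dyadic_double R n j.+1); exact/ltW/dyadic_lt.
Qed.

Lemma dyadic_inside (R : realType) (a b : R) : 0 <= a -> a < b -> b <= 1 ->
  exists n j, [/\ (j < 2 ^ n)%N, a <= dyadic R n j & dyadic R n j.+1 <= b].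
Proof.
move=> a0 ab b1; have e0 : 0 < (b - a) / 2 by rewrite divr_gt0// subr_gt0.
have [N /(_ _ (leqnn N)) HN] := expn2_small e0.
have p0 : 0 < 2 ^+ N :> R by rewrite exprn_gt0.
have /andP[t1 t2] := truncn_itv (mulr_ge0 a0 (ltW p0)).
set i := Num.trunc _ in t1 t2.
have jb : dyadic R N i.+2 <= b.
  have := dyadicB R N i.+1; have := dyadicB R N i.
  have : dyadic R N i <= a by rewrite /dyadic ler_pdivrMr.
  lra.
(* The point with index [i] may lie to the left of [a], the next one does not; the mesh is below
   half of [b - a], so one more step stays below [b]. *)
exists N, i.+1; split => //.
  rewrite -(ltr_nat R) natrX -[ltRHS]mul1r -ltr_pdivrMr//.
  exact: lt_le_trans (dyadic_lt R N i.+1) (le_trans jb b1).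
by rewrite /dyadic ler_pdivlMr// ltW.
Qed.

Lemma total_variation_infty (R : realType) (f : R -> R) (a b : R) :
  0 <= a -> a < b -> b <= 1 ->
  (forall n j (C : R), (j < 2 ^ n)%N ->
     ~ forall m, tsum (fun n j => `|incr f n j|) m n j <= C) ->
  total_variation a b f = +oo%E.
Proof.
move=> a0 ab b1 fC; have [n [j [jn aj jb]]] := dyadic_inside a0 ab b1.
have lr := ltW (dyadic_lt R n j).
have : (total_variation (dyadic R n j) (dyadic R n j.+1) f <= total_variation a b f)%E.
  rewrite (@total_variationD _ a b (dyadic R n j))//; last exact: le_trans lr jb.
  rewrite (@total_variationD _ (dyadic R n j) b (dyadic R n j.+1))//.
  by rewrite addeC -addeA leeDl// adde_ge0// total_variation_ge0.
have := total_variation_ge0 f (ltW ab).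
case: (total_variation a b f) => [C _ TVC|//|//].
exfalso; apply: (fC n j C jn) => m; rewrite -lee_fin.
by apply: le_trans TVC; exact: tsum_le_total_variation.
Qed.

(** * Dyadic increments of solutions of the functional equation *)

(** The bounds on the parameters in [E_set], with denominators cleared. *)
Definition admissible (R : realType) (b u v : R) : Prop :=
  [/\ 0 < b, b < 1, b < 1 + u, b * (1 + u) < 1 & - b < v /\ v * (1 - b) < b].

Lemma E_set_admissible (R : realType) (b u v : R) :
  E_set (b, u, v) -> admissible b u v.
Proof.
case=> /andP[b0 b1] /andP[bu ub] /andP[bv vb] _; split=> //.
- lra.
- have : b * u < b * (b^-1 - 1) by rewrite ltr_pM2l.
  by rewrite mulrBr mulfV ?gt_eqF//; lra.
- by split => //; rewrite -ltr_pdivlMr// subr_gt0.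
Qed.

Definition conjugacy (R : realType) (b u v : R) (f : R -> R) : Prop :=
  [/\ forall x, 0 <= x <= 1 -> 0 <= f x <= 1,
      forall x, 0 <= x <= 2^-1 ->
        f x = b * (1 + u) * f (2 * x) / (u * f (2 * x) + 1) &
      forall x, 2^-1 <= x <= 1 ->
        f x = ((1 - b + v) * f (2 * x - 1) + b) / (v * f (2 * x - 1) + 1)].

Lemma solves_conjugacy (R : realType) (g : curve R) t f :
  solves_functional_equation (A0 g t) (A1 g t) f ->
  conjugacy (b1 g t) (c0 g t) (c1 g t) f.
Proof.
case=> _ f01 fl fr; split => // x xh; [rewrite fl//|rewrite fr//];
  by rewrite /Phi /A0 /A1 /mx2 !mxE/= ?addr0.
Qed.

Lemma add1_mul_gt0 (R : realType) (y z : R) :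
  -1 < y -> 0 <= z <= 1 -> 0 < 1 + y * z.
Proof. by move=> y1 /andP[z0 z1]; have [y0|y0] := leP 0 y; nra. Qed.

Definition left_share (R : realType) (b y : R) : R := b * (1 + y) / (1 + b * y).

Section Conjugacy.
Context (R : realType) (g : curve R) (t : R) (f : R -> R).
Let b := b1 g t.
Let u := c0 g t.
Let v := c1 g t.
Hypothesis adm : admissible b u v.
Hypothesis fE : conjugacy b u v f.

(** Parameter [y] of the Moebius map [z (1 + y) / (1 + y z)] which, applied to [f], gives [f] on the
    interval [(n, j)] up to affine rescaling. Odd indices are right halves. *)
Fixpoint ratio (n j : nat) : R :=
  if n is n'.+1 then
    if odd j then G1 g t (ratio n' j./2) else G0 g t (ratio n' j./2)
  else 0.

Lemma ratio_even n j : ratio n.+1 j.*2 = G0 g t (ratio n j).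
Proof. by rewrite /= odd_double doubleK. Qed.

Lemma ratio_odd n j : ratio n.+1 j.*2.+1 = G1 g t (ratio n j).
Proof. by rewrite /= odd_double uphalf_double. Qed.

Lemma G0_add1 y : 1 + G0 g t y = (1 + u) * (1 + b * y).
Proof. rewrite /G0 -/b -/u; ring. Qed.

Lemma G1_add1 y : 1 + b * y != 0 ->
  1 + G1 g t y = (1 + v) * (1 + y) / (1 + b * y).
Proof. by rewrite /G1 -/b -/v addrC => h; field; rewrite addrC in h *. Qed.

Lemma add1_b_gt0 y : -1 < y -> 0 < 1 + b * y.
Proof. by case: adm => *; rewrite mulrC add1_mul_gt0// !ltW. Qed.

Lemma add1_v_gt0 : 0 < 1 + v.
Proof. case: adm => *; lra. Qed.

(** The factored forms of [1 + G0] and [1 + G1] preserve positivity; this keeps all later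
    denominators positive. *)
Lemma ratio_gtN1 n j : -1 < ratio n j.
Proof.
elim: n j => [|n IH] j; first by rewrite /= ltrN10.
have := IH j./2; set y := ratio n j./2 => y1 /=; rewrite -/y.
have by0 := add1_b_gt0 y1; case: adm => [b0 bl bu _ _].
case: ifP => _; rewrite -subr_gt0 opprK addrC.
  rewrite G1_add1 ?gt_eqF// divr_gt0// mulr_gt0 ?add1_v_gt0//; lra.
by rewrite G0_add1 mulr_gt0//; lra.
Qed.

(** [f 0] is a fixed point of the left Moebius map, and the factor that belongs to the other fixed
    point is positive on [[0, 1]]. *)
Lemma conjugacy0 : f 0 = 0.
Proof.
case: adm => b0 bl bu bu1 [bv vb]; case: fE => f01 fl fr.
have := fl 0; rewrite mulr0 lexx invr_ge0 ler0n => /(_ isT).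
have /andP[z0 z1] : 0 <= f 0 <= 1 by apply: f01; rewrite lexx ler01.
set z := f 0 in z0 z1 * => ez.
have d0 : 0 < u * z + 1 by nra.
have : z * (u * z + 1) = b * (1 + u) * z by rewrite {1}ez divfK ?gt_eqF.
move=> e; have : z * (u * z + 1 - b * (1 + u)) = 0 by lra.
move/eqP; rewrite mulf_eq0 => /orP[/eqP//|/eqP].
have : 0 < u * z + 1 - b * (1 + u) by nra.
lra.
Qed.

Lemma conjugacy1 : f 1 = 1.
Proof.
case: adm => b0 bl bu bu1 [bv vb]; case: fE => f01 fl fr.
have := fr 1; rewrite mulr1 lexx invf_le1 ?ler1n// => /(_ isT).
have -> : 2 - 1 = 1 :> R by ring.
have /andP[z0 z1] : 0 <= f 1 <= 1 by apply: f01; rewrite lexx ler01.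
set z := f 1 in z0 z1 * => ez.
have d0 : 0 < v * z + 1 by nra.
have : z * (v * z + 1) = (1 - b + v) * z + b by rewrite {1}ez divfK ?gt_eqF.
move=> e; have : (z - 1) * (v * z + b) = 0 by lra.
move/eqP; rewrite mulf_eq0 => /orP[/eqP|/eqP]; first lra.
have : 0 < v * z + b by nra.
lra.
Qed.

Lemma incr_root : incr f 0 0 = 1.
Proof. by rewrite /incr /dyadic expr0 !divr1 conjugacy0 conjugacy1 subr0. Qed.

Lemma conjugacy_half : f 2^-1 = b.
Proof.
case: fE => f01 fl fr; have := fr 2^-1.
rewrite lexx invf_le1 ?ler1n// => /(_ isT).
by rewrite mulfV ?pnatr_eq0// subrr conjugacy0 !mulr0 !add0r divr1.
Qed.

(* The Moebius map of the dyadic interval [(n, j)], normalised to fix 0 and 1. *)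
Lemma conjugacy_dyadic n j z : (j < 2 ^ n)%N -> 0 <= z <= 1 ->
  f ((j%:R + z) / 2 ^+ n) = f (dyadic R n j) +
    incr f n j * (f z * (1 + ratio n j) / (1 + ratio n j * f z)).
Proof.
case: adm => b0 bl bu bu1 [bv vb]; case: (fE) => f01 fl fr.
elim: n j z => [|n IH] j z.
  rewrite expn0 ltnS leqn0 => /eqP -> z01.
  rewrite /incr /dyadic /= expr0 !divr1 conjugacy0 conjugacy1 addr0 mul0r.
  by rewrite !add0r addr0 divr1 mulr1 subr0 mul1r.
move=> jn z01; have fz := f01 z z01; have h2 : (2 : R) != 0 by rewrite pnatr_eq0.
(* [k] is the parent, and the parity [i] selects the branch of the functional equation. *)
rewrite -(odd_double_half j) in jn *; set i := odd j in jn *; set k := j./2 in jn *.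
have kn : (k < 2 ^ n)%N.
  by move: jn; rewrite expnS mul2n -(ltn_double k); apply: leq_ltn_trans; rewrite leq_addl.
have /andP[z0 z1] := z01.
have y1 := ratio_gtN1 n k; set y := ratio n k in y1 *.
have e2 : (2 : R) ^+ n != 0 by rewrite expf_neq0.
have ex (w : R) : ((i + k.*2)%:R + w) / 2 ^+ n.+1 = (k%:R + (i%:R + w) / 2) / 2 ^+ n.
  by rewrite natrD -mul2n natrM exprS; field; rewrite e2.
have i01 : 0 <= (i%:R : R) <= 1 by case: (i); rewrite /= ?lexx ?ler01.
have ih (w : R) : 0 <= w <= 1 -> f (((i + k.*2)%:R + w) / 2 ^+ n.+1) =
    f (dyadic R n k) + incr f n k *
      (f ((i%:R + w) / 2) * (1 + y) / (1 + y * f ((i%:R + w) / 2))).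
  move=> /andP[w0 w1]; rewrite ex IH//; move: i01 => /andP[i0 i1].
  by apply/andP; split; lra.
rewrite ih// /incr.
have -> : dyadic R n.+1 (i + k.*2) = ((i + k.*2)%:R + 0) / 2 ^+ n.+1 by rewrite addr0.
have -> : dyadic R n.+1 (i + k.*2).+1 = ((i + k.*2)%:R + 1) / 2 ^+ n.+1.
  by rewrite /dyadic natr1.
rewrite !ih ?lexx ?ler01//; rewrite -/(incr f n k).
have p1 := add1_b_gt0 y1; have p2 := add1_mul_gt0 (ratio_gtN1 n.+1 (i + k.*2)) fz.
have p3 : 0 < 1 + y by lra.
case: (i) p2.
  rewrite [nat_of_bool true]/= add1n ratio_odd -/y => p2.
  have -> : f ((1 + 0) / 2) = b by rewrite addr0 div1r conjugacy_half.
  have -> : f ((1 + 1) / 2) = 1 by rewrite mulfV// conjugacy1.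
  have -> : f ((1 + z) / 2) = ((1 - b + v) * f z + b) / (v * f z + 1).
    rewrite fr; last by apply/andP; split; lra.
    by have -> : 2 * ((1 + z) / 2) - 1 = z by field.
  have := f01 ((1 + z) / 2); rewrite fr; last by apply/andP; split; lra.
  have -> : 2 * ((1 + z) / 2) - 1 = z by field.
  have z2 : 0 <= (1 + z) / 2 <= 1 by apply/andP; split; lra.
  move=> /(_ z2) /(add1_mul_gt0 y1).
  have v1 : -1 < v by lra.
  have := add1_mul_gt0 v1 fz; move: p2; rewrite /G1 -/b -/v.
  move: (f z) (f (dyadic R n k)) (incr f n k) => w L D p2 p4 p5.
  move: p2 p5.
  have e4 : v * w + 1 != 0 by rewrite addrC gt_eqF.
  have e1 : b * y + 1 != 0 by rewrite addrC gt_eqF.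
  (* Over common denominators the positivity facts become the nonvanishing conditions that [field]
     asks for. *)
  have -> : 1 + y * (((1 - b + v) * w + b) / (v * w + 1)) =
    (v * w + 1 + y * ((1 - b + v) * w + b)) / (v * w + 1) by field.
  have -> : 1 + ((1 - b + v) * y + v) / (b * y + 1) * w =
    (b * y + 1 + ((1 - b + v) * y + v) * w) / (b * y + 1) by field.
  rewrite pmulr_lgt0 ?invr_gt0; last by rewrite addrC.
  rewrite pmulr_lgt0 ?invr_gt0; last by rewrite addrC.
  by move=> p2 p5; field; rewrite e4 e1 !gt_eqF.
rewrite [nat_of_bool false]/= add0n ratio_even -/y => p2.
have -> : f ((0 + 0) / 2) = 0 by rewrite addr0 mul0r conjugacy0.
have -> : f ((0 + 1) / 2) = b by rewrite add0r div1r conjugacy_half.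
have -> : f ((0 + z) / 2) = b * (1 + u) * f z / (u * f z + 1).
  rewrite fl; last by apply/andP; split; lra.
  by have -> : 2 * ((0 + z) / 2) = z by field.
have := f01 ((0 + z) / 2); rewrite fl; last by apply/andP; split; lra.
have -> : 2 * ((0 + z) / 2) = z by field.
have z2 : 0 <= (0 + z) / 2 <= 1 by apply/andP; split; lra.
move=> /(_ z2) /(add1_mul_gt0 y1).
have u1 : -1 < u by lra.
have := add1_mul_gt0 u1 fz; move: p2; rewrite /G0 -/b -/u.
move: (f z) (f (dyadic R n k)) (incr f n k) => w L D p2 p4 p5.
move: p5; have e4 : u * w + 1 != 0 by rewrite addrC gt_eqF.
have -> : 1 + y * (b * (1 + u) * w / (u * w + 1)) =
  (u * w + 1 + y * (b * (1 + u) * w)) / (u * w + 1) by field.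
rewrite pmulr_lgt0 ?invr_gt0; last by rewrite addrC.
by move=> p5; field; rewrite e4 !gt_eqF// mulrC.
Qed.

(** The midpoint is [z = 1/2] in [conjugacy_dyadic], where [f] equals [b]. *)
Lemma incr_left n j : (j < 2 ^ n)%N ->
  incr f n.+1 j.*2 = left_share b (ratio n j) * incr f n j.
Proof.
move=> jn; rewrite {1}/incr dyadic_double.
have -> : dyadic R n.+1 j.*2.+1 = (j%:R + 2^-1) / 2 ^+ n.
  by rewrite /dyadic -natr1 -mul2n natrM exprS; field; rewrite expf_neq0 ?pnatr_eq0.
rewrite conjugacy_dyadic//; last by rewrite invr_ge0 ler0n/= invf_le1// ler1n.
by rewrite conjugacy_half addrAC subrr add0r mulrC /left_share (mulrC b (ratio _ _)).
Qed.

Lemma incr_right n j : (j < 2 ^ n)%N ->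
  incr f n.+1 j.*2.+1 = (1 - left_share b (ratio n j)) * incr f n j.
Proof.
by move=> jn; have := incr_split f n j; rewrite incr_left// => e; rewrite mulrBl mul1r {1}e; ring.
Qed.

Lemma left_share_compl y : -1 < y -> 1 - left_share b y = (1 - b) / (1 + b * y).
Proof.
by move=> /add1_b_gt0 h; rewrite /left_share; field; rewrite gt_eqF.
Qed.

Lemma incr_gt0 n j : (j < 2 ^ n)%N -> 0 < incr f n j.
Proof.
case: adm => b0 bl _ _ _.
elim: n j => [|n IH] j.
  rewrite expn0 ltnS leqn0 => /eqP ->.
  by rewrite incr_root ltr01.
have y1 := ratio_gtN1 n j./2; have by0 := add1_b_gt0 y1.
have jh : (j./2 < 2 ^ n)%N -> 0 < incr f n j./2 by apply: IH.
rewrite -(odd_double_half j); case: (odd j); rewrite ?add1n ?add0n.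
  rewrite expnS mul2n ltn_Sdouble => /[dup] kn /jh i0.
  by rewrite incr_right// left_share_compl// mulr_gt0// divr_gt0// subr_gt0.
rewrite expnS mul2n ltn_double => /[dup] kn /jh i0.
by rewrite incr_left// mulr_gt0// divr_gt0// mulr_gt0//; lra.
Qed.

(** The induction bounds the number of doublings that bring [z] into the right half, where the right
    branch is positive. *)
Lemma conjugacy_gt0 z : 0 < z <= 1 -> 0 < f z.
Proof.
case: adm => b0 bl bu bu1 [bv vb]; case: (fE) => f01 fl fr /andP[z0 z1].
have [N /(_ _ (leqnn N)) /ltW HN] := expn2_small z0.
elim: N z z0 z1 HN => [|N IH] z z0 z1 zN.
  have -> : z = 1 by apply/eqP; rewrite eq_le z1/= -[leLHS]invr1 -[1 in leLHS](expr0 2).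
  by rewrite conjugacy1.
have [zh|zh] := leP z 2^-1.
  rewrite fl; last by rewrite zh ltW.
  have w0 : 0 < f (2 * z).
    apply: IH; [lra|lra|].
    by move: zN; rewrite exprS invfM => zN; rewrite -ler_pdivrMl.
  have u1 : -1 < u by lra.
  have u2 : 0 < 1 + u by lra.
  have w01 : 0 <= f (2 * z) <= 1 by apply: f01; apply/andP; split; lra.
  by rewrite divr_gt0// ?mulr_gt0// addrC add1_mul_gt0.
rewrite fr; last by rewrite ltW.
have w01 : 0 <= f (2 * z - 1) <= 1 by apply: f01; apply/andP; split; lra.
have v1 : -1 < v by lra.
have v2 := add1_mul_gt0 v1 w01.
rewrite divr_gt0//; last by rewrite addrC.
by move: w01 v2 => /andP[]; move: (f _) => w w0 w1 v2; nra.
Qed.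
End Conjugacy.

(** * Duality and monotonicity *)

Lemma dual_admissible (R : realType) (b u v : R) : admissible b u v ->
  admissible (1 - b) (- (v / (1 + v))) (- (u / (1 + u))).
Proof.
case=> b0 b1 bu bu1 [bv vb].
have u1 : 0 < 1 + u by lra.
have v1 : 0 < 1 + v by lra.
have eu : 1 + - (u / (1 + u)) = (1 + u)^-1 by field; rewrite gt_eqF.
have ev : 1 + - (v / (1 + v)) = (1 + v)^-1 by field; rewrite gt_eqF.
split; [lra|lra| | |split].
- by rewrite ev -[ltRHS]mul1r ltr_pdivlMr//; lra.
- by rewrite ev ltr_pdivrMr//; lra.
- by rewrite ltrN2 ltr_pdivrMr//; lra.
- have -> : - (u / (1 + u)) * (1 - (1 - b)) = (- u * b) / (1 + u) by field; rewrite gt_eqF.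
  by rewrite ltr_pdivrMr//; lra.
Qed.

(** Reflecting both axes of the unit square exchanges the two branches; the reflected branches have
    the parameters of the dual curve. *)
Lemma dual_conjugacy (R : realType) (b u v : R) (f : R -> R) :
  admissible b u v -> conjugacy b u v f ->
  conjugacy (1 - b) (- (v / (1 + v))) (- (u / (1 + u))) (fun x => 1 - f (1 - x)).
Proof.
move=> [b0 b1 bu bu1 [bv vb]] [f01 fl fr].
have u1 : -1 < u by lra.
have v1 : -1 < v by lra.
have u1' : 0 < 1 + u by lra.
have v1' : 0 < 1 + v by lra.
split=> x /andP[x0 x1].
- have /andP[] : 0 <= f (1 - x) <= 1 by apply: f01; apply/andP; split; lra.
  by move=> ? ?; apply/andP; split; lra.
- rewrite fr; last by apply/andP; split; lra.
  have -> : 2 * (1 - x) - 1 = 1 - 2 * x by ring.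
  have w01 : 0 <= f (1 - 2 * x) <= 1 by apply: f01; apply/andP; split; lra.
  have := add1_mul_gt0 v1 w01; move: (f _) => w h.
  field; rewrite !gt_eqF//=.
  by have -> : - v * (1 - w) + (1 + v) = 1 + v * w by ring.
- rewrite fl; last by apply/andP; split; lra.
  have -> : 1 - (2 * x - 1) = 2 * (1 - x) by ring.
  have w01 : 0 <= f (2 * (1 - x)) <= 1 by apply: f01; apply/andP; split; lra.
  have := add1_mul_gt0 u1 w01; move: (f _) => w h.
  field; rewrite !gt_eqF//=.
  by have -> : - u * (1 - w) + (1 + u) = 1 + u * w by ring.
Qed.

Lemma conjugacy_lt1 (R : realType) (g : curve R) t f z :
  admissible (b1 g t) (c0 g t) (c1 g t) ->
  conjugacy (b1 g t) (c0 g t) (c1 g t) f -> 0 <= z < 1 -> f z < 1.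
Proof.
move=> adm fE /andP[z0 z1].
have := @conjugacy_gt0 R (dual g) t _ (dual_admissible adm) (dual_conjugacy adm fE) (1 - z).
have -> : 1 - (1 - z) = z by ring.
by move=> h; rewrite -subr_gt0; apply: h; apply/andP; split; lra.
Qed.

(** Induction on [N] with [2 ^- N <= x - v]: two points of one half are moved apart by doubling, and
    the branches are increasing; points of different halves are separated by the value [b] at
    1/2. *)
Lemma conjugacy_mono (R : realType) (g : curve R) t f v x :
  admissible (b1 g t) (c0 g t) (c1 g t) ->
  conjugacy (b1 g t) (c0 g t) (c1 g t) f -> 0 <= v -> v < x -> x <= 1 -> f v < f x.
Proof.
move=> adm fE v0 vx x1.
have f0 := conjugacy0 adm fE; have f1 := conjugacy1 adm fE.
have lt1 z : 0 <= z < 1 -> f z < 1 by exact: conjugacy_lt1 fE.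
have gt0 z : 0 < z <= 1 -> 0 < f z by exact: conjugacy_gt0 adm fE z.
case: (adm) => b0 bl bu bu1 [bv vb]; case: (fE) => f01 fl fr.
set b := b1 g t in b0 bl bu bu1 bv vb fl fr *.
set u := c0 g t in bu bu1 fl *; set w := c1 g t in bv vb fr *.
have u1 : -1 < u by lra.
have w1 : -1 < w by lra.
have phi0 y z : 0 <= y -> y < z -> z <= 1 ->
    b * (1 + u) * y / (u * y + 1) < b * (1 + u) * z / (u * z + 1).
  move=> y0 yz z1; rewrite -subr_gt0.
  have hy : 0 < u * y + 1 by rewrite addrC add1_mul_gt0//; apply/andP; split; lra.
  have hz : 0 < u * z + 1 by rewrite addrC add1_mul_gt0//; apply/andP; split; lra.
  have -> : b * (1 + u) * z / (u * z + 1) - b * (1 + u) * y / (u * y + 1) =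
      b * (1 + u) * (z - y) / ((u * z + 1) * (u * y + 1)).
    by field; rewrite !gt_eqF.
  by rewrite divr_gt0 ?mulr_gt0 ?subr_gt0//; lra.
have phi1 y z : 0 <= y -> y < z -> z <= 1 ->
    ((1 - b + w) * y + b) / (w * y + 1) < ((1 - b + w) * z + b) / (w * z + 1).
  move=> y0 yz z1; rewrite -subr_gt0.
  have hy : 0 < w * y + 1 by rewrite addrC add1_mul_gt0//; apply/andP; split; lra.
  have hz : 0 < w * z + 1 by rewrite addrC add1_mul_gt0//; apply/andP; split; lra.
  have -> : ((1 - b + w) * z + b) / (w * z + 1) - ((1 - b + w) * y + b) / (w * y + 1) =
      (1 - b) * (1 + w) * (z - y) / ((w * z + 1) * (w * y + 1)).
    by field; rewrite !gt_eqF.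
  by rewrite divr_gt0 ?mulr_gt0 ?subr_gt0//; lra.
have fh : f 2^-1 = b by exact: conjugacy_half adm fE.
have left_b z : 0 <= z < 2^-1 -> f z < b.
  move=> /andP[z0 z1]; rewrite -fh fl ?z0 ?ltW// [ltRHS]fl; last by rewrite lexx invr_ge0 ler0n.
  rewrite mulfV ?pnatr_eq0// f1; apply: phi0 => //.
    by have /andP[] : 0 <= f (2 * z) <= 1 by apply: f01; apply/andP; split; lra.
  by apply: lt1; apply/andP; split; lra.
have right_b z : 2^-1 < z <= 1 -> b < f z.
  move=> /andP[z0 z1]; rewrite -fh fr; last by rewrite lexx invf_le1 ?ler1n.
  rewrite [ltRHS]fr; last by rewrite ltW.
  rewrite mulfV ?pnatr_eq0// subrr f0; apply: phi1 => //.
    by apply: gt0; apply/andP; split; lra.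
  by have /andP[] : 0 <= f (2 * z - 1) <= 1 by apply: f01; apply/andP; split; lra.
have [N /(_ _ (leqnn N)) /ltW HN] : exists N, forall n, (N <= n)%N -> 2 ^- n < x - v.
  by apply: expn2_small; rewrite subr_gt0.
elim: N v x v0 vx x1 HN => [|N IH] v x v0 vx x1.
  by rewrite expr0 invr1 => xv; have -> : v = 0 by [lra]; have -> : x = 1 by [lra]; rewrite f0 f1.
rewrite exprS invfM => xv.
have [xh|xh] := leP x 2^-1.
  rewrite fl ?[ltRHS]fl; [|apply/andP; split; lra|apply/andP; split; lra].
  have v2 : 0 <= f (2 * v) <= 1 by apply: f01; apply/andP; split; lra.
  have x2 : 0 <= f (2 * x) <= 1 by apply: f01; apply/andP; split; lra.
  by apply: phi0; [case/andP: v2|apply: IH; lra|case/andP: x2].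
have [vh|vh] := leP 2^-1 v.
  rewrite fr ?[ltRHS]fr; [|apply/andP; split; lra|apply/andP; split; lra].
  have v2 : 0 <= f (2 * v - 1) <= 1 by apply: f01; apply/andP; split; lra.
  have x2 : 0 <= f (2 * x - 1) <= 1 by apply: f01; apply/andP; split; lra.
  by apply: phi1; [case/andP: v2|apply: IH; lra|case/andP: x2].
by apply: (@lt_trans _ _ b); [apply: left_b|apply: right_b]; apply/andP; split; lra.
Qed.

(** * Range of the ratios *)

Section RatioRange.
Context (R : realType) (g : curve R).
Let b := b1 g 0.
Let u := c0 g 0.
Let v := c1 g 0.
Hypothesis adm : admissible b u v.

Lemma alpha_le : [/\ alpha g <= 0, alpha g <= u / (1 - b * (1 + u)) & alpha g <= v / b].
Proof. by rewrite /alpha -/b -/u -/v !ge_min !lexx !orbT. Qed.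

Lemma beta_ge : [/\ 0 <= beta g, u / (1 - b * (1 + u)) <= beta g & v / b <= beta g].
Proof. by rewrite /beta -/b -/u -/v !le_max !lexx !orbT. Qed.

Lemma alpha_gtN1 : -1 < alpha g.
Proof.
case: adm => b0 bl bu bu1 [bv vb].
rewrite /alpha -/b -/u -/v !lt_min ltrN10/=; apply/andP; split.
  have : 0 < (1 + u) * (1 - b) by rewrite mulr_gt0//; lra.
  by rewrite ltr_pdivlMr ?subr_gt0//; lra.
by rewrite ltr_pdivlMr//; lra.
Qed.

(** [u / (1 - b (1 + u))] and [v / b] are fixed points of the increasing maps [G0] and [G1], so the
    interval spanned by them and the root value 0 is invariant. *)
Lemma ratio_itv n j : alpha g <= ratio g 0 n j <= beta g.
Proof.
case: adm => b0 bl bu bu1 [bv vb].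
have [a0 a1 a2] := alpha_le; have [e0 e1 e2] := beta_ge; have aN := alpha_gtN1.
elim: n j => [|n IH] j; first by rewrite /= a0 e0.
have /andP[y1 y2] := IH j./2; rewrite /=; move: (ratio _ _ _ _) y1 y2 => y y1 y2.
have by0 : 0 < b * y + 1.
  by have := add1_b_gt0 (t := 0) adm (lt_le_trans aN y1); rewrite addrC.
rewrite ler_pdivlMr ?subr_gt0// in a1; rewrite ler_pdivrMr ?subr_gt0// in e1.
rewrite ler_pdivlMr// in a2; rewrite ler_pdivrMr// in e2.
move: (alpha g) (beta g) a0 a1 a2 e0 e1 e2 aN y1 y2 => al be a0 a1 a2 e0 e1 e2 aN y1 y2.
case: ifP => _; rewrite ?/G1 ?/G0 -/b -/u -/v.
  have v1 : 0 < (1 - b) * (1 + v) by rewrite mulr_gt0//; lra.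
  rewrite ler_pdivlMr// ler_pdivrMr//; apply/andP; split; rewrite -subr_ge0.
    have ba : 0 < b * al + 1 by nra.
    (* Up to positive factors, the first summand is the increase of [G1] from [al] to [y], and the
       second is the displacement of [al] by [G1], nonnegative because [al] is at most the fixed
       point [v / b]. *)
    have -> : (1 - b + v) * y + v - al * (b * y + 1) =
      ((1 - b) * (1 + v) * (y - al) + (v - al * b) * (al + 1) * (b * y + 1)) / (b * al + 1).
      by field; rewrite gt_eqF.
    by rewrite divr_ge0 ?(ltW ba)// addr_ge0// ?mulr_ge0 ?subr_ge0// ltW//; lra.
  have ba : 0 < b * be + 1 by nra.
  have -> : be * (b * y + 1) - ((1 - b + v) * y + v) =
    ((1 - b) * (1 + v) * (be - y) + (be * b - v) * (be + 1) * (b * y + 1)) / (b * be + 1).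
    by field; rewrite gt_eqF.
  by rewrite divr_ge0 ?(ltW ba)// addr_ge0// ?mulr_ge0 ?subr_ge0// ltW//; lra.
have s0 : 0 < b * (1 + u) by rewrite mulr_gt0//; lra.
move: (b * (1 + u)) s0 a1 e1 => s s0 a1 e1.
by apply/andP; split; nra.
Qed.

(** As the ratios stay in [[alpha, beta]], each share is bounded below with [alpha] in its numerator
    and [beta] in its denominator. *)
Lemma conjugacy_doubling f : conjugacy b u v f ->
  exists2 c, 0 < c & doubling c f.
Proof.
move=> fE; case: (adm) => b0 bl bu bu1 [bv vb]; have aN := alpha_gtN1.
have [e0 _ _] := beta_ge.
have be0 : 0 < 1 + b * beta g by rewrite ltr_wpDr// mulr_ge0// ltW.
exists (Num.min (b * (1 + alpha g) / (1 + b * beta g)) ((1 - b) / (1 + b * beta g))).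
  by rewrite lt_min !divr_gt0 ?mulr_gt0 ?subr_gt0//; lra.
move=> n j jn; have i0 := incr_gt0 adm fE jn.
have /andP[y1 y2] := ratio_itv n j; have yN := ratio_gtN1 adm n j.
have by0 := add1_b_gt0 (t := 0) adm yN.
rewrite (incr_left adm fE)// (incr_right adm fE)// (left_share_compl (t := 0) adm)//.
rewrite !ler_pM2r//; split => //; rewrite ge_min.
  apply/orP; left; rewrite /left_share; apply: ler_pM.
  - by rewrite mulr_ge0//; lra.
  - by rewrite invr_ge0 ltW.
  - by rewrite ler_pM2l//; lra.
  - by rewrite lef_pV2// lerD2l ler_pM2l.
apply/orP; right; rewrite ler_pM2l ?subr_gt0//.
by rewrite lef_pV2// lerD2l ler_pM2l.
Qed.
End RatioRange.

(** * Derivatives of the ratios *)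

(** Product rule with ring products in place of scalings, so that derivative values can be matched
    by [ring] and [field]. *)
Lemma is_derive_mul (R : realType) (f g : R -> R) (x df dg : R) :
  is_derive x 1 f df -> is_derive x 1 g dg ->
  is_derive x 1 (fun t => f t * g t) (df * g x + f x * dg).
Proof.
move=> hf hg; apply: (@is_derive_eq _ _ _ _ _ _ _ _ (is_deriveM hf hg)).
by rewrite /GRing.scale/= addrC (mulrC (g x)).
Qed.

Lemma is_derive_add (R : realType) (f g : R -> R) (x df dg : R) :
  is_derive x 1 f df -> is_derive x 1 g dg ->
  is_derive x 1 (fun t => f t + g t) (df + dg).
Proof. move=> hf hg; exact: is_deriveD. Qed.

Lemma is_derive_div (R : realType) (f g : R -> R) (x df dg : R) :
  is_derive x 1 f df -> is_derive x 1 g dg -> g x != 0 ->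
  is_derive x 1 (fun t => f t / g t) ((df * g x - f x * dg) / g x ^+ 2).
Proof.
move=> hf hg g0; have hv := is_deriveV g0 hg.
apply: (@is_derive_eq _ _ _ _ _ _ _ _ (is_derive_mul hf hv)).
by rewrite /GRing.scale/=; field.
Qed.

Lemma is_derive_const (R : realType) (a x : R) : is_derive x 1 (fun=> a) 0.
Proof. exact: is_derive_cst. Qed.

Lemma is_derive_ident (R : realType) (x : R) : is_derive x 1 (fun t : R => t) 1.
Proof. exact: is_derive_id. Qed.

Lemma is_derive_derive1 (R : realType) (f : R -> R) (x df : R) :
  is_derive x 1 f df -> derive1 f x = df.
Proof. by move=> h; rewrite derive1E; apply: derive_val. Qed.

Lemma derivable_is_derive1 (R : realType) (f : R -> R) (x : R) :
  derivable f x 1 -> is_derive x 1 f (derive1 f x).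
Proof. by move=> h; rewrite derive1E; exact: derivableP. Qed.

Section Tangent.
Context (R : realType) (g : curve R).
Let b := b1 g 0.
Let u := c0 g 0.
Let v := c1 g 0.
Let b' := derive1 (b1 g) 0.
Let u' := derive1 (c0 g) 0.
Let v' := derive1 (c1 g) 0.
Hypothesis adm : admissible b u v.
Hypothesis db : derivable (b1 g) 0 1.
Hypothesis du : derivable (c0 g) 0 1.
Hypothesis dv : derivable (c1 g) 0 1.

Let hb : is_derive (0 : R) 1 (b1 g) b' := derivable_is_derive1 db.
Let hu : is_derive (0 : R) 1 (c0 g) u' := derivable_is_derive1 du.
Let hv : is_derive (0 : R) 1 (c1 g) v' := derivable_is_derive1 dv.

(** Chain rule along a moving argument: the last summand is the partial derivative in [y] times
    [dY], the rest the partial derivative in [t]. *)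
Lemma is_derive_G0 (Y : R -> R) dY : is_derive (0 : R) 1 Y dY ->
  is_derive (0 : R) 1 (fun t => G0 g t (Y t))
    ((b' * (1 + u) + b * u') * Y 0 + u' + b * (1 + u) * dY).
Proof.
move=> hY; rewrite /G0.
have h1 := is_derive_add (is_derive_const 1 0) hu.
have h2 := is_derive_add (is_derive_mul (is_derive_mul hb h1) hY) hu.
by apply: (@is_derive_eq _ _ _ _ _ _ _ _ h2); rewrite -/b -/u; ring.
Qed.

Lemma is_derive_G1 (Y : R -> R) dY : is_derive (0 : R) 1 Y dY -> 1 + b * Y 0 != 0 ->
  is_derive (0 : R) 1 (fun t => G1 g t (Y t))
    ((((v' - b') * Y 0 + v') * (b * Y 0 + 1) -
      ((1 - b + v) * Y 0 + v) * (b' * Y 0)) / (b * Y 0 + 1) ^+ 2 +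
     (1 - b) * (1 + v) / (b * Y 0 + 1) ^+ 2 * dY).
Proof.
move=> hY; rewrite addrC => y0; rewrite /G1.
have hNb : is_derive (0 : R) 1 (fun t => - b1 g t) (- b') by exact: is_deriveN.
have h1 := is_derive_add (is_derive_add (is_derive_const 1 0) hNb) hv.
have h2 := is_derive_add (is_derive_mul h1 hY) hv.
have h3 := is_derive_add (is_derive_mul hb hY) (is_derive_const 1 0).
have h4 := is_derive_div h2 h3 y0.
apply: (@is_derive_eq _ _ _ _ _ _ _ _ h4).
by rewrite -/b -/v; field.
Qed.

Lemma slope_G0 y : derive1 (fun t => G0 g t y) 0 = (b' * (1 + u) + b * u') * y + u' /\
  derive1 (G0 g 0) y = b * (1 + u).
Proof.
split.
  by rewrite (is_derive_derive1 (is_derive_G0 (is_derive_const y 0))) mulr0 addr0.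
have h := is_derive_add (is_derive_mul (is_derive_const (b * (1 + u)) y) (is_derive_ident y))
  (is_derive_const u y).
by rewrite (is_derive_derive1 h) mul0r mulr1 add0r addr0.
Qed.

Lemma slope_G1 y : 1 + b * y != 0 ->
  derive1 (fun t => G1 g t y) 0 = (((v' - b') * y + v') * (b * y + 1) -
      ((1 - b + v) * y + v) * (b' * y)) / (b * y + 1) ^+ 2 /\
  derive1 (G1 g 0) y = (1 - b) * (1 + v) / (b * y + 1) ^+ 2.
Proof.
move=> y0; split.
  by rewrite (is_derive_derive1 (is_derive_G1 (is_derive_const y 0) y0)) mulr0 addr0.
rewrite addrC in y0.
have h1 := is_derive_add (is_derive_mul (is_derive_const (1 - b + v) y) (is_derive_ident y))
  (is_derive_const v y).
have h2 := is_derive_add (is_derive_mul (is_derive_const b y) (is_derive_ident y))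
  (is_derive_const 1 y).
by rewrite (is_derive_derive1 (is_derive_div h1 h2 y0)); field.
Qed.

Lemma ratio_derive_exists n j : exists dY, is_derive (0 : R) 1 (fun t => ratio g t n j) dY.
Proof.
elim: n j => [|n IH] j; first by exists 0; exact: is_derive_const.
have [dY hY] := IH j./2; rewrite /=; case: (odd j).
  eexists; apply: (is_derive_G1 hY).
  by rewrite gt_eqF// (add1_b_gt0 (t := 0) adm)// (ratio_gtN1 adm).
eexists; exact: (is_derive_G0 hY).
Qed.

(** With [s] the partial derivative in [y], the one in [t] is [(1 - s) * d], so the chain rule
    yields a convex combination of a slope value and the derivative at the parent. That [s < 1]
    comes from admissibility for [G0] and from [delta1_defined] for [G1]. *)
Lemma ratio_derive_slopes n j dY : delta1_defined g ->
  is_derive (0 : R) 1 (fun t => ratio g t n.+1 j) dY ->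
  exists s d dZ, [/\ 0 < s, s < 1,
    slope_values g (if odd j then G1 g else G0 g) d,
    is_derive (0 : R) 1 (fun t => ratio g t n j./2) dZ &
    dY = (1 - s) * d + s * dZ].
Proof.
case: (adm) => b0 bl bu bu1 [bv vb].
move=> d1; have [dZ hZ] := ratio_derive_exists n j./2.
have yab := ratio_itv adm n j./2.
have y0 := add1_b_gt0 (t := 0) adm (ratio_gtN1 adm n j./2).
set y := ratio g 0 n j./2 in yab y0.
have yab' : y \in `[alpha g, beta g] by rewrite in_itv.
move=> hY; have eY := is_derive_derive1 hY; rewrite -eY {eY hY}.
have -> : (fun t => ratio g t n.+1 j) =
  (fun t => if odd j then G1 g t (ratio g t n j./2) else G0 g t (ratio g t n j./2)) by [].
case: (odd j).
  have [e1 e2] := slope_G1 (lt0r_neq0 y0).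
  have s1 : derive1 (G1 g 0) y < 1 by exact: d1.
  exists (derive1 (G1 g 0) y), (derive1 (fun t => G1 g t y) 0 / (1 - derive1 (G1 g 0) y)), dZ.
  split => //.
  - rewrite e2 divr_gt0//; first by rewrite mulr_gt0//; lra.
    by rewrite exprn_gt0// addrC.
  - by exists y.
  rewrite (is_derive_derive1 (is_derive_G1 hZ (lt0r_neq0 y0))) -/y -e1 -e2.
  by field; rewrite subr_eq0 gt_eqF.
have [e1 e2] := slope_G0 y.
exists (derive1 (G0 g 0) y), (derive1 (fun t => G0 g t y) 0 / (1 - derive1 (G0 g 0) y)), dZ.
split => //.
- by rewrite e2 mulr_gt0//; lra.
- by rewrite e2.
- by exists y.
rewrite (is_derive_derive1 (is_derive_G0 hZ)) -/y -e1 -e2.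
by field; rewrite subr_eq0 gt_eqF// e2.
Qed.

(** Averaging preserves the bound; [m <= 0] is the case of the root, whose ratio is constantly 0. *)
Lemma ratio_derive_ge m n j dY : delta1_defined g -> m <= 0 ->
  (forall d, slope_values g (G0 g) d -> m <= d) ->
  (forall d, slope_values g (G1 g) d -> m <= d) ->
  is_derive (0 : R) 1 (fun t => ratio g t n j) dY -> m <= dY.
Proof.
move=> d1 m0 H0 H1; elim: n j dY => [|n IH] j dY.
  by move=> h; rewrite -(is_derive_derive1 h) (is_derive_derive1 (is_derive_const 0 0)).
move=> /(ratio_derive_slopes d1)[s [d [dZ [s0 s1 sd /IH mZ ->]]]].
have md : m <= d by move: sd; case: (odd j) => [/H1|/H0].
nra.
Qed.

Lemma ratio_derive_le m n j dY : delta1_defined g -> 0 <= m ->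
  (forall d, slope_values g (G0 g) d -> d <= m) ->
  (forall d, slope_values g (G1 g) d -> d <= m) ->
  is_derive (0 : R) 1 (fun t => ratio g t n j) dY -> dY <= m.
Proof.
move=> d1 m0 H0 H1; elim: n j dY => [|n IH] j dY.
  by move=> h; rewrite -(is_derive_derive1 h) (is_derive_derive1 (is_derive_const 0 0)).
move=> /(ratio_derive_slopes d1)[s [d [dZ [s0 s1 sd /IH mZ ->]]]].
have md : d <= m by move: sd; case: (odd j) => [/H1|/H0].
nra.
Qed.

(** The bounded quantity is the numerator of the jump of the first derivative. The maximum case will
    be applied to the dual curve. *)
Lemma condND_drift : condND_min g \/ condND_max g ->
  exists2 e, 0 < e & forall n j dY, is_derive (0 : R) 1 (fun t => ratio g t n j) dY ->
    e <= `|b' * (1 + ratio g 0 n j) + b * (1 - b) * dY|.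
Proof.
case: (adm) => b0 bl bu bu1 [bv vb]; have aN := alpha_gtN1 adm.
have bb : 0 < b * (1 - b) by rewrite mulr_gt0// subr_gt0.
case=> -[d1 [d0 [d1' [[_ lb0] [_ lb1]]]]]; rewrite -/b' -/b => h.
  set m := Num.min 0 _ in h; have m0 : m <= 0 by rewrite ge_min lexx.
  exists (b' * (alpha g + 1) + b * (1 - b) * m) => // n j dY hY.
  have mY : m <= dY.
    apply: ratio_derive_ge hY => // d sd.
      by apply: le_trans (lb0 _ sd); rewrite !ge_min lexx !orbT.
    by apply: le_trans (lb1 _ sd); rewrite !ge_min lexx !orbT.
  have /andP[ya _] := ratio_itv adm n j.
  (* [b'] is positive since [m <= 0] and [alpha g + 1 > 0] in [h]; hence the first term is least at
     the ratio [alpha g]. *)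
  apply: le_trans (ler_norm _); have bp : 0 < b' by nra.
  by apply: lerD; [rewrite ler_pM2l//; lra|rewrite ler_pM2l].
set m := Num.max 0 _ in h; have m0 : 0 <= m by rewrite le_max lexx.
exists (- (b' * (alpha g + 1) + b * (1 - b) * m)); first by rewrite oppr_gt0.
move=> n j dY hY.
have mY : dY <= m.
  apply: ratio_derive_le hY => // d sd.
    by apply: le_trans (lb0 _ sd) _; rewrite !le_max lexx !orbT.
  by apply: le_trans (lb1 _ sd) _; rewrite !le_max lexx !orbT.
have /andP[ya _] := ratio_itv adm n j.
rewrite -normrN; apply: le_trans (ler_norm _); rewrite lerN2; have bp : b' < 0 by nra.
by apply: lerD; [rewrite ler_nM2l//; lra|rewrite ler_pM2l].
Qed.
End Tangent.

(** * First derivatives *)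

(** A surplus [q] in the left half, missing in the right one, changes the two slopes in proportion
    to [1/p] and [- 1/(1 - p)], which differ by [1/(p (1 - p))]. *)
Lemma jump_eq (R : realType) (h f : R -> R) n j (p q : R) :
  incr h n.+1 j.*2 = p * incr h n j -> incr f n.+1 j.*2 = p * incr f n j + q ->
  p != 0 -> 1 - p != 0 -> incr h n j != 0 ->
  jump h f n j = q / (p * (1 - p) * incr h n j).
Proof.
move=> eh ef p0 q0 h0.
have eh' : incr h n.+1 j.*2.+1 = (1 - p) * incr h n j.
  by have := incr_split h n j; rewrite eh => e; rewrite mulrBl mul1r {1}e; ring.
have ef' : incr f n.+1 j.*2.+1 = (1 - p) * incr f n j - q.
  by have := incr_split f n j; rewrite ef => e; rewrite mulrBl mul1r {1}e; ring.
by rewrite /jump /slope eh eh' ef ef'; field; rewrite h0 p0 q0.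
Qed.

Section FirstDerivative.
Context (R : realType) (g : curve R) (F : R -> R -> R).
Let b := b1 g 0.
Hypothesis db : derivable (b1 g) 0 1.
Hypothesis du : derivable (c0 g) 0 1.
Hypothesis dv : derivable (c1 g) 0 1.
Hypothesis adm : \forall t \near (0 : R), admissible (b1 g t) (c0 g t) (c1 g t).
Hypothesis fE : \forall t \near (0 : R), conjugacy (b1 g t) (c0 g t) (c1 g t) (F t).

Let adm0 : admissible (b1 g 0) (c0 g 0) (c1 g 0) := nbhs_singleton adm.
Let fE0 : conjugacy (b1 g 0) (c0 g 0) (c1 g 0) (F 0) := nbhs_singleton fE.

Lemma near_midpoint n j : (j < 2 ^ n)%N -> \forall t \near (0 : R),
  F t (dyadic R n j) + left_share (b1 g t) (ratio g t n j) *
    (F t (dyadic R n j.+1) - F t (dyadic R n j)) = F t (dyadic R n.+1 j.*2.+1).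
Proof.
move=> jn; apply: filterS2 adm fE => t admt fEt.
by have := incr_left admt fEt jn; rewrite /incr dyadic_double => <-; rewrite addrC subrK.
Qed.

Lemma is_derive_left_share n j dY : is_derive (0 : R) 1 (fun t => ratio g t n j) dY ->
  is_derive (0 : R) 1 (fun t => left_share (b1 g t) (ratio g t n j))
    ((derive1 (b1 g) 0 * (1 + ratio g 0 n j) + b * (1 - b) * dY) /
     (1 + b * ratio g 0 n j) ^+ 2).
Proof.
move=> hY; have hb := derivable_is_derive1 db.
have h1 := is_derive_mul hb (is_derive_add (is_derive_const 1 0) hY).
have h2 := is_derive_add (is_derive_const 1 0) (is_derive_mul hb hY).
have y0 : 1 + b1 g 0 * ratio g 0 n j != 0.
  by rewrite gt_eqF// (add1_b_gt0 (t := 0) adm0)// (ratio_gtN1 adm0).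
apply: (@is_derive_eq _ _ _ _ _ _ _ _ (is_derive_div h1 h2 y0)).
by rewrite -/b in y0 *; field.
Qed.

(** The new points of a level are midpoints, whose values are built from the endpoint values and the
    differentiable share. *)
Lemma derivable_dyadic n j : (j <= 2 ^ n)%N ->
  derivable (fun t => F t (dyadic R n j)) 0 1.
Proof.
elim: n j => [|n IH] j.
  rewrite expn0 leq_eqVlt ltnS leqn0 orbC => /orP[] /eqP ->.
    apply: (@near_eq_derivable _ _ _ (fun=> 0 : R)); last exact: derivable_cst.
    by apply: filterS2 adm fE => t a f; rewrite /dyadic mul0r (conjugacy0 a f).
  apply: (@near_eq_derivable _ _ _ (fun=> 1 : R)); last exact: derivable_cst.
  by apply: filterS2 adm fE => t a f; rewrite /dyadic expr0 divr1 (conjugacy1 a f).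
rewrite -(odd_double_half j) expnS mul2n; case: (odd j); last first.
  by rewrite add0n leq_double dyadic_double; exact: IH.
rewrite add1n ltn_double => jn.
apply: near_eq_derivable (near_midpoint jn) _.
have [dY hY] := ratio_derive_exists adm0 db du dv n j./2.
have [h1 _] := is_derive_left_share hY.
apply: derivableD; first exact/IH/ltnW.
apply: derivableM; first exact: h1.
by apply: derivableB; [exact: IH|exact/IH/ltnW].
Qed.

(** Differentiating the midpoint identity gives [jump_eq] with [q] equal to [p'] times the increment
    of [F 0], hence the jump [p' / (p (1 - p))]. *)
Lemma jump_first_derivative n j dY : (j < 2 ^ n)%N ->
  is_derive (0 : R) 1 (fun t => ratio g t n j) dY ->
  jump (F 0) (f_ F 1) n j =
    (derive1 (b1 g) 0 * (1 + ratio g 0 n j) + b * (1 - b) * dY) /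
    (b * (1 - b) * (1 + ratio g 0 n j)).
Proof.
move=> jn hY; have yN := ratio_gtN1 adm0 n j.
have y0 := add1_b_gt0 (t := 0) adm0 yN.
have i0 := incr_gt0 adm0 fE0 jn.
have hl := derivable_is_derive1 (derivable_dyadic (ltnW jn)).
have hr := derivable_is_derive1 (derivable_dyadic jn).
have hNl : is_derive (0 : R) 1 (fun t => - F t (dyadic R n j))
  (- derive1 (fun t => F t (dyadic R n j)) 0) by exact: is_deriveN.
have hm := is_derive_add hl (is_derive_mul (is_derive_left_share hY) (is_derive_add hr hNl)).
have hm' := is_derive_derive1 (near_eq_is_derive (near_midpoint jn) hm).
set y := ratio g 0 n j in yN y0 hm' *; set p := left_share b y.
set p' := _ / (1 + b * y) ^+ 2 in hm'.
case: adm0 => b0 bl _ _ _; rewrite -/b in b0 bl y0.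
have e1 : p * (1 - p) = b * (1 - b) * (1 + y) / (1 + b * y) ^+ 2.
  by rewrite /p /left_share; field; rewrite gt_eqF.
have p0 : p != 0 by rewrite gt_eqF// divr_gt0// mulr_gt0//; lra.
have q0 : 1 - p != 0.
  by rewrite /p (left_share_compl (t := 0) adm0)// gt_eqF// divr_gt0// subr_gt0.
rewrite (jump_eq (p := p) (q := p' * incr (F 0) n j))//.
- by rewrite e1 /p'; field; rewrite !gt_eqF//; lra.
- exact: incr_left adm0 fE0 _ _ jn.
- rewrite {1}/incr dyadic_double {1}/f_ derive1n1 hm' /incr /f_ !derive1n1 -/b -/y -/p.
  by ring.
- by rewrite gt_eqF.
Qed.

Lemma jump_first_derivative_bound : condND_min g \/ condND_max g ->
  exists2 e, 0 < e & forall n j, (j < 2 ^ n)%N -> e <= `|jump (F 0) (f_ F 1) n j|.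
Proof.
move=> /(condND_drift adm0 db du dv)[e e0 He].
case: (adm0) => b0 bl _ _ _; rewrite -/b in b0 bl.
have bb : 0 < b * (1 - b) by rewrite mulr_gt0// subr_gt0.
have [be0 _ _] := beta_ge g.
have be1 : 0 < 1 + beta g by lra.
exists (e / (b * (1 - b) * (1 + beta g))); first by rewrite divr_gt0// mulr_gt0.
move=> n j jn; have [dY hY] := ratio_derive_exists adm0 db du dv n j.
have yN := ratio_gtN1 adm0 n j; have /andP[_ yb] := ratio_itv adm0 n j.
have y0 : 0 < 1 + ratio g 0 n j by lra.
rewrite (jump_first_derivative jn hY) normrM normfV (gtr0_norm (mulr_gt0 bb y0)).
apply: ler_pM; [exact: ltW|by rewrite invr_ge0 ltW// mulr_gt0|exact: He|].
rewrite lef_pV2; [|by rewrite posrE mulr_gt0|by rewrite posrE mulr_gt0].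
by rewrite ler_pM2l// lerD2l.
Qed.
End FirstDerivative.

(** * Reflection of the dyadic tree *)

Lemma dyadic_flip (R : realType) n j : (j <= 2 ^ n)%N ->
  1 - dyadic R n j = dyadic R n (2 ^ n - j).
Proof.
by move=> jn; rewrite /dyadic natrB// natrX mulrBl divff.
Qed.

Lemma incr_flip (R : realType) (f h : R -> R) n j : (j < 2 ^ n)%N ->
  (forall m i, (i <= 2 ^ m)%N -> h (dyadic R m i) = - f (1 - dyadic R m i)) ->
  incr h n j = incr f n (2 ^ n - j.+1).
Proof.
move=> jn hf; rewrite /incr !hf ?(ltnW jn)// !dyadic_flip ?(ltnW jn)//.
by rewrite -(subnSK jn); ring.
Qed.

(** The relation between [f] and [f'] is asked at dyadic points, where derivatives in [t] are known
    to exist; the constant 1 in [h'] cancels in increments. *)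
Lemma slope_flip (R : realType) (h f h' f' : R -> R) n j : (j < 2 ^ n)%N ->
  (forall x, h' x = 1 - h (1 - x)) ->
  (forall m i, (i <= 2 ^ m)%N -> f' (dyadic R m i) = - f (1 - dyadic R m i)) ->
  slope h' f' n j = slope h f n (2 ^ n - j.+1).
Proof.
move=> jn hh ff; rewrite /slope (incr_flip jn ff); congr (_ / _).
have -> : incr h' n j = incr (fun x => - h (1 - x)) n j by rewrite /incr !hh; ring.
by apply: incr_flip.
Qed.

(** Reflection exchanges left and right halves, which reverses the sign. *)
Lemma jump_flip (R : realType) (h f h' f' : R -> R) n j : (j < 2 ^ n)%N ->
  (forall x, h' x = 1 - h (1 - x)) ->
  (forall m i, (i <= 2 ^ m)%N -> f' (dyadic R m i) = - f (1 - dyadic R m i)) ->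
  jump h f n j = - jump h' f' n (2 ^ n - j.+1).
Proof.
move=> jn hh ff; have kn : (2 ^ n - j.+1 < 2 ^ n)%N.
  by rewrite ltn_subLR// addSn ltnS leq_addl.
set k := (2 ^ n - j.+1)%N in kn *.
rewrite /jump !(slope_flip _ hh ff) ?ltn_double_exp ?ltn_doubleS_exp//.
have ek : (k + j.+1 = 2 ^ n)%N by rewrite subnK.
have -> : (2 ^ n.+1 - k.*2.+1 = j.*2.+1)%N.
  by rewrite expnS -ek -!mul2n; lia.
have -> : (2 ^ n.+1 - k.*2.+2 = j.*2)%N.
  by rewrite expnS -ek -!mul2n; lia.
by rewrite opprB.
Qed.

(** * Condition (L) *)

Lemma derive1n_horner (R : realType) (I : set R) (f : R -> R) (P : {poly R}) k t :
  open I -> (forall t, I t -> f t = P.[t]) -> I t ->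
  derive1n k f t = P^`(k).[t].
Proof.
move=> oI fP; elim: k t => [|k IH] t It; first by rewrite derive1n0 derivn0 fP.
rewrite derive1nS derivnS derivE !derive1E.
apply: near_eq_derive; near=> s; apply: IH; near: s.
exact: open_nbhs_nbhs.
Unshelve. all: by end_near. Qed.

Lemma derivn_horner0 (R : realType) (P : {poly R}) k : P^`(k).[0] = P`_k * k`!%:R.
Proof. by rewrite horner_coef0 coef_derivn addn0 ffactnn mulr_natr. Qed.

Section LinearCurve.
Context (R : realType) (I : set R) (g : curve R) (F : R -> R -> R) (a : R).
Hypothesis I_open : open I.
Hypothesis I0 : I 0.
Hypothesis g_lin : forall t, I t -> [/\ b1 g t = t + a, c0 g t = 0 & c1 g t = 0].
Hypothesis adm : forall t, I t -> admissible (b1 g t) (c0 g t) (c1 g t).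
Hypothesis fE : forall t, I t -> conjugacy (b1 g t) (c0 g t) (c1 g t) (F t).

Lemma linear_ratio t n j : I t -> ratio g t n j = 0.
Proof.
move=> /g_lin[_ u0 v0]; elim: n j => [//|n IH] j /=; rewrite IH /G1 /G0 u0 v0.
by case: ifP => _; rewrite !mulr0 !addr0 ?mul0r.
Qed.

Lemma linear_midpoint t n j : I t -> (j < 2 ^ n)%N ->
  F t (dyadic R n.+1 j.*2.+1) = F t (dyadic R n j) + (t + a) * incr (F t) n j.
Proof.
move=> It jn; have := incr_left (adm It) (fE It) jn.
rewrite /left_share linear_ratio// mulr0 !addr0 divr1 mulr1.
by have [-> _ _] := g_lin It; rewrite {1}/incr dyadic_double => <-; rewrite addrC subrK.
Qed.

(** Polynomial dependence on [t] makes the derivatives of every order at 0 readable from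
    coefficients. *)
Lemma linear_polynomial n j : (j <= 2 ^ n)%N ->
  exists P : {poly R}, forall t, I t -> F t (dyadic R n j) = P.[t].
Proof.
elim: n j => [|n IH] j.
  rewrite expn0 leq_eqVlt ltnS leqn0 orbC => /orP[] /eqP ->.
    by exists 0 => t It; rewrite /dyadic mul0r horner0 (conjugacy0 (adm It) (fE It)).
  by exists 1 => t It; rewrite /dyadic expr0 divr1 hornerC (conjugacy1 (adm It) (fE It)).
rewrite -(odd_double_half j) expnS mul2n; case: (odd j); last first.
  by rewrite add0n leq_double dyadic_double; exact: IH.
rewrite add1n ltn_double => jn.
have [P HP] := IH _ (ltnW jn); have [Q HQ] := IH _ jn.
exists (P + ('X + a%:P) * (Q - P)) => t It.
by rewrite linear_midpoint// /incr HP// HQ// !hornerE.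
Qed.

(** Leibniz rule for the factor [t + a], whose second and higher derivatives vanish. *)
Lemma linear_incr_left k n j : (j < 2 ^ n)%N ->
  incr (f_ F k.+1) n.+1 j.*2 =
  a * incr (f_ F k.+1) n j + k.+1%:R * incr (f_ F k) n j.
Proof.
move=> jn.
have [P HP] := linear_polynomial (ltnW jn); have [Q HQ] := linear_polynomial jn.
have HM t : I t -> F t (dyadic R n.+1 j.*2.+1) = (P + ('X + a%:P) * (Q - P)).[t].
  by move=> It; rewrite linear_midpoint// /incr HP// HQ// !hornerE.
rewrite /incr dyadic_double /f_ !(derive1n_horner _ I_open HP I0).
rewrite !(derive1n_horner _ I_open HQ I0) (derive1n_horner _ I_open HM I0).
rewrite !derivn_horner0 mulrDl !coefD coefXM coefCM !coefD !coefN /=.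
by rewrite factS natrM; ring.
Qed.

Lemma linear_jump k n j : (j < 2 ^ n)%N ->
  jump (F 0) (f_ F k.+1) n j =
  k.+1%:R / (a * (1 - a)) * slope (F 0) (f_ F k) n j.
Proof.
move=> jn; have i0 := incr_gt0 (adm I0) (fE I0) jn.
have [b0 bl _ _ _] := adm I0; have [ba _ _] := g_lin I0.
rewrite ba add0r in b0 bl.
have el : incr (F 0) n.+1 j.*2 = a * incr (F 0) n j.
  rewrite (incr_left (adm I0) (fE I0) jn) linear_ratio// ba add0r /left_share.
  by rewrite mulr0 !addr0 divr1 mulr1.
have a0 : a != 0 by rewrite gt_eqF.
have a1 : 1 - a != 0 by rewrite gt_eqF// subr_gt0.
rewrite (jump_eq el (linear_incr_left k jn))// ?gt_eqF// /slope.
by field; rewrite a0 a1 gt_eqF.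
Qed.

Lemma linear_jump_factor k : k.+1%:R / (a * (1 - a)) != 0.
Proof.
have [b0 bl _ _ _] := adm I0; have [ba _ _] := g_lin I0.
rewrite ba add0r in b0 bl.
by rewrite gt_eqF// divr_gt0 ?ltr0n// mulr_gt0// subr_gt0.
Qed.

Lemma linear_slope0 n j : (j < 2 ^ n)%N -> slope (F 0) (f_ F 0) n j = 1.
Proof.
by move=> jn; rewrite /slope divff// gt_eqF// (incr_gt0 (adm I0) (fE I0)).
Qed.

Lemma linear_slope_cvg0_at k (x : R) :
  jump (F 0) (f_ F k.+1) n (index_at x n) @[n --> \oo] --> 0 ->
  slope (F 0) (f_ F k) n (index_at x n) @[n --> \oo] --> 0.
Proof.
have e : (fun n => slope (F 0) (f_ F k) n (index_at x n)) =
  (fun n => (k.+1%:R / (a * (1 - a)))^-1 * jump (F 0) (f_ F k.+1) n (index_at x n)).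
  apply/funext => n; rewrite linear_jump ?index_at_lt// mulKf//.
  exact: linear_jump_factor.
move=> h; rewrite e -[X in _ --> X](mulr0 (k.+1%:R / (a * (1 - a)))^-1).
by apply: cvgMr.
Qed.

Lemma linear_slope_cvg0_in_mass k n j : (j < 2 ^ n)%N ->
  cvg0_in_mass (F 0) (jump (F 0) (f_ F k.+1)) n j ->
  cvg0_in_mass (F 0) (slope (F 0) (f_ F k)) n j.
Proof.
move=> jn h e d e0 d0; have [c c0 dc] := conjugacy_doubling (adm I0) (fE I0).
set q := k.+1%:R / (a * (1 - a)).
have q0 : 0 < `|q| by rewrite normr_gt0 linear_jump_factor.
have [N HN] := h (`|q| * e) d (mulr_gt0 q0 e0) d0.
exists N => m /HN; apply: le_trans; apply: (mass_le _ dc) => // n' j' jn'.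
by rewrite linear_jump// -/q (normrM q) ler_pM2l.
Qed.

(* By the previous two lemmas [jump -> 0] forces [slope -> 0] for the derivative
   of one order less, hence also [jump -> 0] there, and so on down to the order
   0, where the slope is 1. *)
Lemma linear_jump_not_cvg0 k (x : R) :
  ~ (jump (F 0) (f_ F k.+1) n (index_at x n) @[n --> \oo] --> 0).
Proof.
have [c c0 dc] := conjugacy_doubling (adm I0) (fE I0).
move=> /linear_slope_cvg0_at; elim: k => [|k IH]; last first.
  by move=> /(jump_cvg0_at c0 dc) /linear_slope_cvg0_at.
under eq_fun do rewrite linear_slope0 ?index_at_lt//.
move=> h; have /eqP : (1 : R) = 0.
  by rewrite -(cvg_lim (@norm_hausdorff _ _) h) lim_cst.
by rewrite oner_eq0.
Qed.

Lemma linear_jump_not_cvg0_in_mass k n j : (j < 2 ^ n)%N ->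
  ~ cvg0_in_mass (F 0) (jump (F 0) (f_ F k.+1)) n j.
Proof.
move=> jn; have [c c0 dc] := conjugacy_doubling (adm I0) (fE I0).
have [i0 _ _] := dc n j jn.
move=> /(linear_slope_cvg0_in_mass jn); elim: k => [|k IH]; last first.
  by move=> /(cvg0_in_mass_jump c0 dc jn) /(linear_slope_cvg0_in_mass jn).
(* All slopes of order 0 equal 1, so at threshold 1 the exceptional mass is the whole increment, not
   half of it. *)
move=> /(_ 1 (incr (F 0) n j / 2) ltr01 (divr_gt0 i0 (ltr0Sn _ 1)))[N /(_ N (leqnn N))].
apply/negP; rewrite -ltNge; apply: (@lt_le_trans _ _ (incr (F 0) n j)); first by lra.
rewrite -[leLHS](tsum_incr (F 0) N); apply: tsum_le => // m i im.
by rewrite linear_slope0// normr1 lexx.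
Qed.
End LinearCurve.

(** * Absolute continuity *)

(** The epsilon-delta form is available for the variation of [mu] viewed as a charge, and this
    variation dominates [mu]. *)
Lemma absolutely_continuous_eps_delta (R : realType)
    (mu : probability (measurableTypeR R) R) :
  mu `<< (@lebesgue_measure R) -> forall e : R, 0 < e ->
  exists2 d : R, 0 < d & forall A : set (measurableTypeR R), measurable A ->
    (lebesgue_measure A < d%:E)%E -> (mu A < e%:E)%E.
Proof.
move=> ac e e0; pose nu := charge_of_finite_measure mu.
have [P [N PN]] := Hahn_decomposition nu.
have [d [d0 Hd]] := @charge_variation_continuous _ _ _ nu P N PN
  (@lebesgue_measure R) ac e e0.
exists d => // A mA /(Hd A mA); apply: le_lt_trans.
by apply: (le_trans _ (abse_charge_variation PN mA)); exact: lee_abs.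
Qed.

Section TreeSet.
Context (R : realType) (Q : nat -> nat -> bool).

(** The set whose measure is [mass]; half-open intervals make siblings disjoint. *)
Fixpoint tset (m n j : nat) : set (measurableTypeR R) :=
  if m is m'.+1 then tset m' n.+1 j.*2 `|` tset m' n.+1 j.*2.+1
  else if Q n j then `]dyadic R n j, dyadic R n j.+1]%classic else set0.

Lemma tset_sub m n j : tset m n j `<=` `]dyadic R n j, dyadic R n j.+1]%classic.
Proof.
elim: m n j => [|m IH] n j x /=; first by case: ifP.
have h1 := dyadic_lt R n.+1 j.*2; have h2 := dyadic_lt R n.+1 j.*2.+1.
rewrite -(dyadic_double R n j) -(dyadic_double R n j.+1) doubleS in_itv/=.
case=> /IH /=; rewrite in_itv/= => /andP[xl xr]; apply/andP; split => //.
  exact: le_trans xr (ltW h2).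
exact: lt_trans h1 xl.
Qed.

Lemma measurable_tset m n j : measurable (tset m n j).
Proof.
elim: m n j => [|m IH] n j /=; first by case: ifP.
exact: measurableU.
Qed.

(** General in the measure, because the same set is evaluated under [mu] and under Lebesgue
    measure. *)
Lemma measure_tset (nu : {measure set (measurableTypeR R) -> \bar R})
    (w : nat -> nat -> R) m n j :
  (forall n j, (j < 2 ^ n)%N ->
     nu `]dyadic R n j, dyadic R n j.+1]%classic = (w n j)%:E) ->
  (j < 2 ^ n)%N ->
  nu (tset m n j) = (tsum (fun n j => if Q n j then w n j else 0) m n j)%:E.
Proof.
move=> nuw; elim: m n j => [|m IH] n j jn /=.
  by case: ifP => _; rewrite ?nuw ?measure0.
rewrite measureU; [|exact: measurable_tset|exact: measurable_tset|].
  rewrite EFinD; congr (_ + _)%E.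
    by apply: IH; exact: ltn_double_exp.
  by apply: IH; exact: ltn_doubleS_exp.
apply/seteqP; split => // x [/tset_sub /= + /tset_sub /=].
by rewrite !in_itv/= => /andP[_ h1] /andP[h2 _]; move: (lt_le_trans h2 h1); rewrite ltxx.
Qed.
End TreeSet.

Section AbsolutelyContinuous.
Context (R : realType) (g : curve R) (f : R -> R).
Let b := b1 g 0.
Let u := c0 g 0.
Let v := c1 g 0.
Hypothesis adm : admissible b u v.
Hypothesis fE : conjugacy b u v f.
Variable mu : probability (measurableTypeR R) R.
Hypothesis mu_f : has_distribution_function mu f.
Hypothesis mu_ac : mu `<< (@lebesgue_measure R).

Lemma mu_dyadic n j : (j < 2 ^ n)%N ->
  mu `]dyadic R n j, dyadic R n j.+1]%classic = (incr f n j)%:E.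
Proof.
move=> jn; have lr := dyadic_lt R n j.
have l0 := dyadic_ge0 R n j; have r1 := dyadic_le1 R jn.
have [_ cdf] := mu_f.
have := cdf (dyadic R n j.+1); rewrite r1 (le_trans l0 (ltW lr)) => /(_ isT).
have -> : `]-oo, dyadic R n j.+1]%classic =
    `]-oo, dyadic R n j]%classic `|` `]dyadic R n j, dyadic R n j.+1]%classic :> set R.
  apply/seteqP; split => x /=; rewrite !in_itv/=.
    by case: (leP x (dyadic R n j)) => h xr; [left|right].
  by case => [h|/andP[//]]; exact: le_trans h (ltW lr).
have -> : mu (`]-oo, dyadic R n j]%classic `|` `]dyadic R n j, dyadic R n j.+1]%classic) =
    (mu `]-oo, dyadic R n j]%classic + mu `]dyadic R n j, dyadic R n j.+1]%classic)%E.
  apply: measureU => //; apply/seteqP; split => // x [] /=.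
  by rewrite !in_itv/= => h /andP[h' _]; move: (lt_le_trans h' h); rewrite ltxx.
rewrite cdf; last by rewrite l0 (le_trans (ltW lr) r1).
move=> e; have {e} : ((f (dyadic R n j))%:E +
    mu `]dyadic R n j, dyadic R n j.+1]%classic - (f (dyadic R n j))%:E)%E =
    ((f (dyadic R n j.+1))%:E - (f (dyadic R n j))%:E)%E by rewrite e.
by rewrite addeAC -EFinB subrr add0e => ->; rewrite -EFinB.
Qed.

Lemma lebesgue_dyadic n j :
  (@lebesgue_measure R) `]dyadic R n j, dyadic R n j.+1]%classic = (2 ^- n)%:E.
Proof.
by rewrite lebesgue_measure_itv/= lte_fin dyadic_lt -EFinB dyadicB.
Qed.

(** Intervals of mean density at least [1 / eta] have total length at most [eta], so absolute
    continuity makes their mass small. *)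
Lemma high_density_mass (e : R) : 0 < e -> exists2 eta, 0 < eta & forall m,
  mass f (fun n j => 2 ^- n <= eta * incr f n j) m 0 0 <= e.
Proof.
move=> e0; have [d d0 Hd] := absolutely_continuous_eps_delta mu_ac e0.
exists (d / 2); first by rewrite divr_gt0.
move=> m; set Q := fun _ _ => _.
have lam : (lebesgue_measure (@tset R Q m 0 0) < d%:E)%E.
  have dl n j : (j < 2 ^ n)%N ->
      (@lebesgue_measure R) `]dyadic R n j, dyadic R n j.+1]%classic = (2 ^- n)%:E.
    by move=> _; exact: lebesgue_dyadic.
  rewrite (@measure_tset R Q (@lebesgue_measure R) (fun n _ => 2 ^- n) m 0 0 dl)//.
  rewrite lte_fin; apply: (@le_lt_trans _ _ (d / 2)); last by lra.
  have e1 := incr_root (t := 0) adm fE.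
  rewrite -[leRHS]mulr1 -[X in _ <= _ * X]e1 -(tsum_incr f m) -tsumZ; apply: tsum_le => // n j jn.
  have i0 := incr_gt0 (t := 0) adm fE jn.
  rewrite /=; case: ifP => [//|_]; apply: mulr_ge0; last exact: ltW.
  by rewrite divr_ge0// ltW.
have := Hd _ (@measurable_tset R Q m 0 0) lam.
rewrite (@measure_tset R Q mu (incr f) m 0 0 mu_dyadic)//.
by rewrite lte_fin => /ltW.
Qed.

(** The identity has bounded variation, so its jumps with respect to [f] tend to 0 in measure. Such
    a jump is [(1/2 - p) 2^-n] divided by [p (1 - p)] times the increment of [f]. *)
Lemma left_share_cvg_half :
  cvg0_in_mass f (fun n j => left_share b (ratio g 0 n j) - 2^-1) 0 0.
Proof.
have [c cpos dc] := conjugacy_doubling adm fE.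
have jc : cvg0_in_mass f (jump f id) 0 0.
  apply: (jump_cvg0_of_bounded_variation (C := 1) cpos dc) => // m.
  have h : forall n j, (j < 2 ^ n)%N -> `|incr (@id R) n j| <= incr (@id R) n j.
    by move=> n j _; rewrite /incr dyadicB ger0_norm// invr_ge0 exprn_ge0.
  apply: le_trans (tsum_le _ h _) _ => //.
  by rewrite tsum_incr /incr dyadicB expr0 invr1.
move=> e d e0 d0.
have d2 : 0 < d / 2 by rewrite divr_gt0.
have [eta eta0 He] := high_density_mass d2.
(* Outside the high-density intervals, a deviation [e] of the share from 1/2 forces a jump of at
   least [e * eta], because [p (1 - p) <= 1]. *)
have [N HN] := jc (e * eta) (d / 2) (mulr_gt0 e0 eta0) d2.
exists N => m Nm; rewrite (splitr d); apply: le_trans (lerD (HN m Nm) (He m)).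
apply: (massU _ dc) => // n j jn ep.
have [//|hd/=] := boolP (2 ^- n <= eta * incr f n j);
  rewrite ?orbT ?orbF//.
have i0 := incr_gt0 (t := 0) adm fE jn.
have yN := ratio_gtN1 (t := 0) adm n j.
have y0 := add1_b_gt0 (t := 0) adm yN.
case: (adm) => b0 bl _ _ _; rewrite -/b in y0.
set p := left_share b _ in ep *.
have p0 : 0 < p by rewrite divr_gt0// mulr_gt0//; lra.
have q0 : 0 < 1 - p by rewrite (left_share_compl (t := 0) adm)// divr_gt0// subr_gt0.
have el := incr_left (t := 0) adm fE jn; rewrite -/b -/p in el.
have ef : incr id n.+1 j.*2 = p * incr id n j + (2^-1 - p) * 2 ^- n :> R.
  by rewrite /incr !dyadicB exprS invfM; ring.
rewrite (jump_eq el ef) ?gt_eqF// -ltNge in hd *.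
have pq : 0 < p * (1 - p) by rewrite mulr_gt0.
have pq1 : p * (1 - p) <= 1 by nra.
clearbody p.
rewrite normf_div (gtr0_norm (mulr_gt0 pq i0)) normrM.
rewrite (gtr0_norm (_ : 0 < 2 ^- n)) ?invr_gt0 ?exprn_gt0//.
rewrite (ler_pdivlMr _ _ (mulr_gt0 pq i0)) distrC -!mulrA.
apply: ler_pM => //; [exact: ltW| |].
  by rewrite (mulrA p) mulr_ge0 ?mulr_ge0//; exact: ltW.
apply: le_trans (ltW hd); rewrite ler_pM2l// -[leRHS]mul1r (mulrA p).
exact: ler_wpM2r (ltW i0) _ _ pq1.
Qed.

(* The ratio at which both halves get the same mass. *)
Let ystar := (1 - 2 * b) / b.

(** The distance of the ratio to [ystar] is at most [C] times the deviation of the share from 1/2,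
    by the upper bound [beta] on the ratios. *)
Lemma ratio_cvg_ystar : cvg0_in_mass f (fun n j => ratio g 0 n j - ystar) 0 0.
Proof.
have [c cpos dc] := conjugacy_doubling adm fE.
case: (adm) => b0 bl _ _ _; have [be0 _ _] := beta_ge g.
have be1 : 0 < 1 + b * beta g by rewrite ltr_wpDr// mulr_ge0// ltW.
pose C := 2 * (1 + b * beta g) / b.
have C0 : 0 < C by rewrite divr_gt0// mulr_gt0.
move=> e d e0 d0; have [N HN] := left_share_cvg_half (divr_gt0 e0 C0) d0.
exists N => m /HN; apply: le_trans; apply: (mass_le _ dc) => // n j jn ey.
have /andP[_ yb] := ratio_itv adm n j.
have y0 := add1_b_gt0 (t := 0) adm (ratio_gtN1 (t := 0) adm n j).
rewrite -/b in y0; rewrite ler_pdivrMr//; apply: le_trans ey _.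
move: (ratio _ _ _ _) yb y0 => y yb y0.
have -> : y - ystar = (left_share b y - 2^-1) * (2 * (1 + b * y) / b).
  by rewrite /ystar /left_share; field; rewrite !gt_eqF.
rewrite normrM ler_wpM2l// gtr0_norm; last by rewrite divr_gt0// mulr_gt0.
by rewrite ler_pM2r ?invr_gt0// ler_pM2l// lerD2l ler_pM2l.
Qed.

(** Otherwise an interval with ratio near [ystar] has a child with ratio near [G ystar], away from
    [ystar]; bad intervals and parents of bad children then exhaust the total mass 1. *)
Lemma fixed_of_cvg (G : R -> R) (K : R) : 0 <= K ->
  (forall n j, ratio g 0 n.+1 j.*2 = G (ratio g 0 n j) \/
               ratio g 0 n.+1 j.*2.+1 = G (ratio g 0 n j)) ->
  (forall y, alpha g <= y <= beta g -> `|G y - G ystar| <= K * `|y - ystar|) ->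
  G ystar = ystar.
Proof.
move=> K0 Gch Glip; apply/eqP/negP => /negP Gy.
have [c cpos dc] := conjugacy_doubling adm fE.
pose dl := `|G ystar - ystar|; have dl0 : 0 < dl by rewrite normr_gt0 subr_eq0.
have K1 : 0 < 1 + K by lra.
(* Chosen so that [dl = r + K * r]: within [r] of [ystar], [G] varies by at most [K * r], which
   leaves distance [r]. *)
pose r := dl / (1 + K); have r0 : 0 < r by rewrite divr_gt0.
pose Q n j := r <= `|ratio g 0 n j - ystar|.
(* Each of the two masses is to be at most 1/3; [c / 3] pays for [mass_child]. *)
pose eps := Num.min 3^-1 (c / 3).
have eps0 : 0 < eps by rewrite lt_min invr_gt0 ltr0n divr_gt0.
have [N HN] := ratio_cvg_ystar r0 eps0.
have h1 : mass f Q N 0 0 <= 3^-1.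
  by apply: le_trans (HN N (leqnn N)) _; rewrite ge_min lexx.
pose P n j := Q n.+1 j.*2 || Q n.+1 j.*2.+1.
have h2 : mass f P N 0 0 <= 3^-1.
  rewrite -(ler_pM2l cpos); apply: (@le_trans _ _ eps); last by rewrite ge_min lexx orbT.
  apply: le_trans (HN N.+1 (leqnSn N)); exact: (mass_child _ cpos dc).
have : 1 <= mass f Q N 0 0 + mass f P N 0 0.
  rewrite -(incr_root (t := 0) adm fE).
  rewrite -[leLHS](tsum_incr f N) -tsumD; apply: tsum_le => // n j jn.
  have [/ltW i0 _ _] := dc n j jn.
  case: ifP => [_|/negbT Qn]; first by rewrite lerDl; case: ifP.
  suff -> : P n j by rewrite add0r.
  have := Glip _ (ratio_itv adm n j); move: Qn; rewrite /P /Q -ltNge.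
  set y := ratio g 0 n j => yr lip.
  have far : r <= `|G y - ystar|.
    have e : dl = r + K * r by rewrite /r; field; rewrite gt_eqF.
    have t : dl <= `|G y - ystar| + `|G y - G ystar|.
      by rewrite addrC /dl (distrC (G y) (G ystar)); exact: ler_distD.
    have : K * `|y - ystar| <= K * r by rewrite ler_wpM2l// ltW.
    lra.
  by have [->|->] := Gch n j; rewrite far ?orbT.
lra.
Qed.

Lemma absolutely_continuous_parameters : u = 1 / (2 * b) - 1 /\ v = 1 - 2 * b.
Proof.
case: (adm) => b0 bl bu bu1 [bv vb]; have aN := alpha_gtN1 adm.
have bn : b != 0 by rewrite gt_eqF.
have bn1 : 1 - b != 0 by rewrite gt_eqF// subr_gt0.
have s0 : 0 < b * (1 + u) by rewrite mulr_gt0//; lra.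
have eb : b * ystar = 1 - 2 * b by rewrite /ystar mulrC divfK.
have fix0 : G0 g 0 ystar = ystar.
  apply: (fixed_of_cvg (ltW s0)) => [n j|y _]; first by left; exact: ratio_even.
  rewrite /G0 -/b -/u.
  have -> : b * (1 + u) * y + u - (b * (1 + u) * ystar + u) = b * (1 + u) * (y - ystar) by ring.
  by rewrite normrM (gtr0_norm s0).
have v1 : 0 < 1 + v by lra.
have al1 : 0 < 1 + b * alpha g by exact: (add1_b_gt0 (t := 0) adm).
have fix1 : G1 g 0 ystar = ystar.
  (* Since [1 + b * ystar = 2 (1 - b)], the factor [1 - b] in the difference of values of [G1]
     cancels; the remaining denominator is least at [alpha g]. *)
  pose K := (1 + v) / (2 * (1 + b * alpha g)).
  have K0 : 0 < K by rewrite divr_gt0// mulr_gt0.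
  apply: (fixed_of_cvg (ltW K0)) => [n j|y /andP[ay _]]; first by right; exact: ratio_odd.
  have y0 : 0 < 1 + b * y by rewrite (lt_le_trans al1)// lerD2l ler_pM2l.
  have -> : G1 g 0 y - G1 g 0 ystar = (1 + v) / (2 * (1 + b * y)) * (y - ystar).
    rewrite /G1 -/b -/v eb /ystar; field.
    by rewrite !gt_eqF//; lra.
  have h : 0 < (1 + v) / (2 * (1 + b * y)) by rewrite divr_gt0// mulr_gt0.
  rewrite normrM (gtr0_norm h) ler_wpM2r// ler_pM2l// lef_pV2 ?posrE ?mulr_gt0//.
  by rewrite ler_pM2l// lerD2l ler_pM2l.
split.
  move: fix0; rewrite /G0 -/b -/u.
  have -> : b * (1 + u) * ystar + u = (1 + u) * (b * ystar) + u by ring.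
  rewrite eb => e.
  have {e} : b * ((1 + u) * (1 - 2 * b) + u) = 1 - 2 * b by rewrite e eb.
  move=> e; have : (1 - b) * (2 * b * (1 + u) - 1) = 0 by lra.
  move/eqP; rewrite mulf_eq0 (negbTE bn1)/= => /eqP e'.
  have e2 : 2 * b * (1 + u) = 1 by lra.
  have {1}-> : u = 2 * b * (1 + u) / (2 * b) - 1 by field.
  by rewrite e2.
move: fix1; rewrite /G1 -/b -/v eb => e.
have n2 : 1 - 2 * b + 1 != 0 by rewrite gt_eqF//; lra.
have {e} : (1 - b + v) * ystar + v = ystar * (1 - 2 * b + 1) by rewrite -[in RHS]e divfK.
move=> e; have {e} : (1 - b + v) * (b * ystar) + v * b = b * ystar * (1 - 2 * b + 1).
  by rewrite -(mulrA b) -e; ring.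
rewrite eb => e; have : (1 - b) * (v - (1 - 2 * b)) = 0 by lra.
by move/eqP; rewrite mulf_eq0 (negbTE bn1)/= subr_eq0 => /eqP.
Qed.
End AbsolutelyContinuous.

(** * The absolutely continuous solution *)

Lemma derivable_slope_cvg (R : realType) (f : R -> R) (x : R) : 0 <= x <= 1 ->
  derivable f x 1 -> slope id f n (index_at x n) @[n --> \oo] --> derive1 f x.
Proof.
move=> x01 df; apply: slope_cvg_at => //.
  by move=> n j _; rewrite /incr dyadicB invr_gt0 exprn_gt0.
move=> e e0.
have : (h^-1 *: ((f \o shift x) (h *: (1 : R)) - f x) : R) @[h --> 0^'] --> derive1 f x.
  by rewrite derive1E; exact: df.
move=> /cvgrPdist_le /(_ e e0) [d /= d0 Hd]; exists d => // v _ vx.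
have [->|vNx] := eqVneq v x; first by rewrite !subrr mulr0 subrr normr0 mulr0.
have h0 : v - x != 0 by rewrite subr_eq0.
have := Hd (v - x); rewrite /= sub0r normrN => /(_ vx h0).
rewrite /GRing.scale/= mulr1 subrK => H.
have -> : f v - f x - derive1 f x * (v - x) =
  - ((derive1 f x - (v - x)^-1 * (f v - f x)) * (v - x)) by field.
by rewrite normrN normrM ler_wpM2r.
Qed.

Section SpecialParameters.
Context (R : realType) (g : curve R) (f : R -> R).
Let b := b1 g 0.
Hypothesis adm : admissible b (c0 g 0) (c1 g 0).
Hypothesis fE : conjugacy b (c0 g 0) (c1 g 0) f.
Hypothesis u_eq : c0 g 0 = 1 / (2 * b) - 1.
Hypothesis v_eq : c1 g 0 = 1 - 2 * b.

(** The Moebius map that fixes 0 and 1 and sends 1/2 to [b]. *)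
Definition special_cdf (x : R) : R := b * x / (b * x + (1 - b) * (1 - x)).

Lemma special_cdf_den_gt0 x : 0 <= x <= 1 -> 0 < b * x + (1 - b) * (1 - x).
Proof.
case: adm => b0 bl _ _ _ /andP[x0 x1]; have [xh|xh] := leP x 2^-1.
  by rewrite ltr_wpDl ?mulr_ge0 ?mulr_gt0//; lra.
by rewrite ltr_wpDr ?mulr_ge0 ?mulr_gt0//; lra.
Qed.

(** For these parameters [special_cdf] satisfies both branches of the functional equation, so
    agreement passes from one dyadic level to the next. *)
Lemma special_cdf_dyadic n j : (j <= 2 ^ n)%N ->
  f (dyadic R n j) = special_cdf (dyadic R n j).
Proof.
case: (adm) => b0 bl bu bu1 [bv vb]; case: (fE) => f01 fl fr.
have bn : b != 0 by rewrite gt_eqF.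
elim: n j => [|n IH] j.
  rewrite expn0 leq_eqVlt ltnS leqn0 orbC => /orP[] /eqP ->.
    by rewrite /dyadic mul0r (conjugacy0 (t := 0) adm fE) /special_cdf mulr0 mul0r.
  rewrite /dyadic expr0 divr1 (conjugacy1 (t := 0) adm fE) /special_cdf.
  by rewrite subrr mulr0 addr0 mulr1 divff.
move=> jn; have p0 : 0 < 2 ^+ n :> R by rewrite exprn_gt0.
have e2 : 2 * dyadic R n.+1 j = dyadic R n j.
  by rewrite /dyadic exprS; field; rewrite gt_eqF.
have x0 := dyadic_ge0 R n.+1 j; have x1 := dyadic_le1 R jn.
have h1 := special_cdf_den_gt0 (introT andP (conj x0 x1)).
have [jh|jh] := leqP j (2 ^ n).
  have y0 := dyadic_ge0 R n j; have y1 := dyadic_le1 R jh.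
  have h2 := special_cdf_den_gt0 (introT andP (conj y0 y1)).
  rewrite fl; last by apply/andP; split; lra.
  rewrite e2 IH// /special_cdf u_eq; move: h1 h2; rewrite -e2.
  move: (dyadic R n.+1 j) => x h1 h2.
  have bx : 0 < b * (2 * x) + (1 - b) * (1 - (2 * x)) by [].
  have e3 : (1 / (2 * b) - 1) * (b * (2 * x) / (b * (2 * x) + (1 - b) * (1 - 2 * x))) + 1 =
     (b * x + (1 - b) * (1 - x)) / (b * (2 * x) + (1 - b) * (1 - 2 * x)).
    by field; rewrite bn gt_eqF.
  by rewrite e3; field; rewrite bn !gt_eqF.
have [i ji] : exists i, j = (2 ^ n + i)%N by exists (j - 2 ^ n)%N; rewrite subnKC// ltnW.
have ni : (i <= 2 ^ n)%N by move: jn; rewrite ji expnS mul2n -addnn leq_add2l.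
have e4 : 2 * dyadic R n.+1 j - 1 = dyadic R n i.
  by rewrite e2 ji /dyadic natrD natrX mulrDl divff ?gt_eqF//; ring.
have y0 := dyadic_ge0 R n i; have y1 := dyadic_le1 R ni.
have h2 := special_cdf_den_gt0 (introT andP (conj y0 y1)).
rewrite fr; last by apply/andP; split; lra.
rewrite e4 IH// /special_cdf v_eq; move: h1 h2; rewrite -e4.
move: (dyadic R n.+1 j) => x h1 h2.
have e3 : (1 - 2 * b) * (b * (2 * x - 1) / (b * (2 * x - 1) + (1 - b) * (1 - (2 * x - 1)))) + 1 =
   2 * (1 - b) * (b * x + (1 - b) * (1 - x)) / (b * (2 * x - 1) + (1 - b) * (1 - (2 * x - 1))).
  by field; rewrite gt_eqF.
rewrite e3; field; rewrite !gt_eqF//; lra.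
Qed.

Lemma special_cdf_derivable x : 0 <= x <= 1 ->
  derivable special_cdf x 1 /\ derive1 special_cdf x != 0.
Proof.
case: (adm) => b0 bl _ _ _ /special_cdf_den_gt0 h.
have hb := is_derive_mul (is_derive_const b x) (is_derive_ident x).
have hN : is_derive x 1 (fun t : R => - t) (-1) by exact: is_deriveNid.
have hc := is_derive_mul (is_derive_const (1 - b) x) (is_derive_add (is_derive_const 1 x) hN).
have hd := is_derive_div hb (is_derive_add hb hc) (lt0r_neq0 h).
split; first by case: hd.
rewrite (is_derive_derive1 hd) gt_eqF// divr_gt0 ?exprn_gt0//.
rewrite [ltRHS](_ : _ = b * (1 - b)); last by ring.
by rewrite mulr_gt0// subr_gt0.
Qed.

(** The slope is a quotient of two ordinary difference quotients, and the one in the denominator has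
    a nonzero limit. *)
Lemma special_slope_cvg (fk : R -> R) (x : R) : 0 <= x <= 1 -> derivable fk x 1 ->
  exists l : R, slope f fk n (index_at x n) @[n --> \oo] --> l.
Proof.
move=> x01 /(derivable_slope_cvg x01) h1.
have [/(derivable_slope_cvg x01) h2 dn0] := special_cdf_derivable x01.
exists (derive1 fk x * (derive1 special_cdf x)^-1).
have -> : (fun n => slope f fk n (index_at x n)) =
  (fun n => slope id fk n (index_at x n) * (slope id special_cdf n (index_at x n))^-1).
  apply/funext => n; have jn := index_at_lt x n.
  have i0 : incr id n (index_at x n) != 0 :> R.
    by rewrite /incr dyadicB invr_eq0 expf_neq0 ?pnatr_eq0.
  have j0 := incr_gt0 (t := 0) adm fE jn.
  have e : incr f n (index_at x n) = incr special_cdf n (index_at x n).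
    by rewrite /incr !special_cdf_dyadic// ltnW.
  by rewrite /slope e in j0 *; field; rewrite i0 gt_eqF.
apply: cvgM => //; exact: cvgV.
Qed.
End SpecialParameters.

(** * Jumps bounded away from zero *)

Lemma jump_bound_not_cvg0 (R : realType) (h f : R -> R) (e x : R) : 0 < e ->
  (forall n j, (j < 2 ^ n)%N -> e <= `|jump h f n j|) ->
  ~ (jump h f n (index_at x n) @[n --> \oo] --> 0).
Proof.
move=> e0 he /cvgrPdist_le /(_ (e / 2)) []; first by rewrite divr_gt0.
move=> N _ /(_ N (leqnn N)) /=; rewrite sub0r normrN.
have := he N _ (index_at_lt x N); lra.
Qed.

Lemma jump_bound_not_cvg0_in_mass (R : realType) c (h f : R -> R) (e : R) n j :
  0 < c -> doubling c h -> (j < 2 ^ n)%N -> 0 < e ->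
  (forall n j, (j < 2 ^ n)%N -> e <= `|jump h f n j|) ->
  ~ cvg0_in_mass h (jump h f) n j.
Proof.
move=> c0 dh jn e0 he; have [i0 _ _] := dh n j jn.
move=> /(_ e (incr h n j / 2) e0 (divr_gt0 i0 (ltr0Sn _ 1)))[N /(_ N (leqnn N))].
apply/negP; rewrite -ltNge; apply: (@lt_le_trans _ _ (incr h n j)); first by lra.
rewrite -[leLHS](tsum_incr h N); apply: tsum_le => // m i im.
by rewrite he.
Qed.

(** The reflected family [1 - F t (1 - x)] solves the equation of the dual curve, and its bound is
    carried back by [jump_flip]. *)
Lemma dual_jump_bound (R : realType) (g : curve R) (F : R -> R -> R) :
  derivable (b1 g) 0 1 -> derivable (c0 g) 0 1 -> derivable (c1 g) 0 1 ->
  (\forall t \near (0 : R), admissible (b1 g t) (c0 g t) (c1 g t)) ->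
  (\forall t \near (0 : R), conjugacy (b1 g t) (c0 g t) (c1 g t) (F t)) ->
  condND_max (dual g) ->
  exists2 e, 0 < e & forall n j, (j < 2 ^ n)%N -> e <= `|jump (F 0) (f_ F 1) n j|.
Proof.
move=> db du dv adm fE nd; have adm0 := nbhs_singleton adm.
have [b0 bl bu bu1 [bv vb]] := adm0.
pose F' t x := 1 - F t (1 - x).
have dual_derivable (w : R -> R) : derivable w 0 1 -> 1 + w 0 != 0 ->
    derivable (fun t => - (w t / (1 + w t))) 0 1.
  move=> /derivable_is_derive1 hw w0.
  have [h _] := is_derive_div hw (is_derive_add (is_derive_const 1 0) hw) w0.
  exact: derivableN.
have [e e0 He] : exists2 e, 0 < e &
    forall n j, (j < 2 ^ n)%N -> e <= `|jump (F' 0) (f_ F' 1) n j|.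
  apply: (@jump_first_derivative_bound R (dual g) F').
  - by apply: derivableB => //; exact: derivable_cst.
  - by apply: dual_derivable => //; rewrite gt_eqF//; lra.
  - by apply: dual_derivable => //; rewrite gt_eqF//; lra.
  - by apply: filterS adm => t; exact: dual_admissible.
  - by apply: filterS2 adm fE => t; exact: dual_conjugacy.
  - by right.
exists e => // n j jn.
rewrite (@jump_flip R _ _ (F' 0) (f_ F' 1))// ?normrN.
  by apply: He; rewrite ltn_subLR// addSn ltnS leq_addl.
move=> m i im; rewrite /f_ !derive1n1 /F' dyadic_flip//.
have hd := derivable_is_derive1 (derivable_dyadic db du dv adm fE (leq_subr i (2 ^ m))).
have hN := is_deriveN hd.
by rewrite (is_derive_derive1 (is_derive_add (is_derive_const 1 0) hN)) add0r.
Qed.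

(** * Divergence of the slopes and infinite variation *)

Unset Implicit Arguments.
Set Strict Implicit.

Theorem theorem6p2 (R : realType) (I : set R) (g : curve R) (F : R -> R -> R)
    (k : nat)
    (I_open : open I) (I_itv : is_interval I) (I0 : I 0)
    (g_E : smooth_curve_in_E I g)
    (F_sol : forall t : R, I t ->
       solves_functional_equation (A0 g t) (A1 g t) (F t))
    (g_ND : condND g)
    (k_ge1 : (1 <= k)%N)
    (k1_or_L : k = 1%N \/ condL I g) :
  ((forall x : R, 0 < x < 1 ->
      forall l : R, ~ (Delta F k x (x + h) @[h --> 0^'] --> l)) /\
   (forall mu0 : probability (measurableTypeR R) R,
      has_distribution_function mu0 (F 0) ->
      mu0 `<< (@lebesgue_measure R) ->
      forall x : R, 0 < x < 1 -> ~ derivable (f_ F k) x 1)) /\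
  (forall a b : R, 0 <= a -> a < b -> b <= 1 ->
     total_variation a b (f_ F k) = +oo%E).
Proof.
have [sb su sv gE] := g_E.
have adm t : I t -> admissible (b1 g t) (c0 g t) (c1 g t).
  by move=> /gE; exact: E_set_admissible.
have fE t : I t -> conjugacy (b1 g t) (c0 g t) (c1 g t) (F t).
  by move=> It; exact/solves_conjugacy/F_sol.
have adm0 := adm 0 I0; have fE0 := fE 0 I0.
have nI : \forall t \near (0 : R), I t by exact: open_nbhs_nbhs.
have [c cpos dc] := conjugacy_doubling adm0 fE0.
(* The two conclusions rest on these facts: the jumps do not tend to 0 along any path, nor in
   measure on any dyadic interval. *)
have [not_at not_mass] :
    (forall x : R, ~ (jump (F 0) (f_ F k) n (index_at x n) @[n --> \oo] --> 0)) /\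
    (forall n j, (j < 2 ^ n)%N -> ~ cvg0_in_mass (F 0) (jump (F 0) (f_ F k)) n j).
  case: k1_or_L => [->|[a _ glin]].
    have nadm : \forall t \near (0 : R), admissible (b1 g t) (c0 g t) (c1 g t).
      by apply: filterS nI; exact: adm.
    have nfE : \forall t \near (0 : R), conjugacy (b1 g t) (c0 g t) (c1 g t) (F t).
      by apply: filterS nI; exact: fE.
    have db := sb 0%N 0 I0; have du := su 0%N 0 I0; have dv := sv 0%N 0 I0.
    have [e e0 he] : exists2 e, 0 < e &
        forall n j, (j < 2 ^ n)%N -> e <= `|jump (F 0) (f_ F 1) n j|.
      case: g_ND => nd; last exact: dual_jump_bound nd.
      by apply: (jump_first_derivative_bound db du dv nadm nfE); left.
    split=> [x|n j jn]; first exact: jump_bound_not_cvg0 e0 he.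
    exact: jump_bound_not_cvg0_in_mass cpos dc jn e0 he.
  case: k k_ge1 => // k' _; split=> [x|n j jn].
    exact: linear_jump_not_cvg0 I_open I0 glin adm fE _ _.
  exact: linear_jump_not_cvg0_in_mass I_open I0 glin adm fE _ _ _ jn.
split; last first.
  move=> a b a0 ab b1; apply: total_variation_infty => // n j C jn fC.
  exact: not_mass jn (jump_cvg0_of_bounded_variation cpos dc jn fC).
split=> [x /andP[x0 x1] l Dl|mu0 mu0F mu0ac x /andP[x0 x1] dfx].
  apply: (not_at x); apply: (jump_cvg0_at cpos dc).
  have x01 : 0 <= x <= 1 by rewrite !ltW.
  have mono v w : 0 <= v -> v < w -> w <= 1 -> F 0 v < F 0 w.
    exact: conjugacy_mono adm0 fE0.
  apply: (@slope_cvg_at R (F 0) (f_ F k) x l x01).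
  - by move=> n j jn; have [] := dc n j jn.
  (* An endpoint equal to [x] is treated apart, since [mono] compares distinct points. *)
  - move=> n j jn /andP[]; rewrite le_eqVlt => /orP[/eqP <-|jx].
      by rewrite lexx => /= _; apply/ltW; have [] := dc n j jn; rewrite subr_gt0.
    rewrite le_eqVlt => /orP[/eqP ->|xj].
      by rewrite lexx andbT; apply/ltW; have [] := dc n j jn; rewrite subr_gt0.
    by rewrite !ltW// mono ?dyadic_ge0 ?dyadic_le1//; exact: ltW.
  (* The punctured limit is multiplied by the increment of [F 0], with [h = v - x]; the case [v = x]
     is trivial. *)
  move=> e e0; move/cvgrPdist_le : Dl => /(_ e e0) [d /= d0 Hd]; exists d => //.
  move=> v /andP[v0 v1] vx; have [->|vNx] := eqVneq v x.
    by rewrite !subrr mulr0 subrr normr0 mulr0.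
  have Fv : F 0 v - F 0 x != 0.
    rewrite subr_eq0; move: vNx; rewrite neq_lt => /orP[h|h].
      by rewrite lt_eqF// mono// ltW.
    by rewrite gt_eqF// mono// ltW.
  have := Hd (v - x); rewrite /= sub0r normrN subr_eq0 => /(_ vx vNx).
  have -> : x + (v - x) = v by ring.
  rewrite /Delta => H.
  have Fv' : F 0 x - F 0 v != 0 by rewrite -opprB oppr_eq0.
  have -> : f_ F k v - f_ F k x - l * (F 0 v - F 0 x) =
    - ((l - (f_ F k x - f_ F k v) / (F 0 x - F 0 v)) * (F 0 v - F 0 x)) by field.
  by rewrite normrN normrM ler_wpM2r.
have [u_eq v_eq] := absolutely_continuous_parameters adm0 fE0 mu0F mu0ac.
have x01 : 0 <= x <= 1 by rewrite !ltW.
have [l hl] := special_slope_cvg adm0 fE0 u_eq v_eq x01 dfx.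
exact: not_at (jump_cvg0_at cpos dc hl).
Qed.
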